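(* Let $\tau>0$, $0\le t<T<\infty$, and let $S$ follow the stochastic volatility model $d\log S_t=(r-\tfrac12\sigma_t^2)\,dt+\sigma_t\,dW_t$ described in the context, with $(S_ue^{-ru})_{u\in[0,T+\tau]}$ a martingale and $\mathbb E\int_0^{T+\tau}\sigma_u^2\,du<\infty$. Let $$\tilde\xi=\sup\{\xi\ge0\,:\,\mathbb E_te^{\xi\,\mathrm{VIX}_T^2}<\infty\}.$$ 1. If $\tilde\xi<\infty$ and $\mathbb E_t\big[S_T^{4\tilde\xi/\tau}\big]<\infty$, then $$\tilde q=\sup\{q\ge0\,:\,\mathbb E_tS_{T+\tau}^{-q}<\infty\}\le\frac{4\tilde\xi}{\tau},$$ and $$\beta_L:=\limsup_{K\searrow0}\frac{\hat\sigma^2(t,K,T+\tau)}{|\log(K/\mathbb E_tS_{T+\tau})|/(T+\tau-t)}\ \ge\ 2-4\left(\sqrt{\Big(\frac{4\tilde\xi}{\tau}\Big)^2+\frac{4\tilde\xi}{\tau}}-\frac{4\tilde\xi}{\tau}\right)\ \ge\ 0 .$$ 2. If $\tilde\xi<\infty$ and $\mathbb E_t\big[S_{T+\tau}^{-4\tilde\xi/\tau}\big]<\infty$, then $\frac{4\tilde\xi}{\tau}\ge1$, $$\tilde p=\sup\{p\ge0\,:\,\mathbb E_tS_T^{1+p}<\infty\}\le\frac{4\tilde\xi}{\tau}-1,$$ and $$\beta_R:=\limsup_{K\nearrow\infty}\frac{\hat\sigma^2(t,K,T)}{\log(K/\mathbb E_tS_T)/(T-t)}\ \ge\ 2-4\left(\sqrt{\Big(\frac{4\tilde\xi}{\tau}-1\Big)^2+\frac{4\tilde\xi}{\tau}-1}-\Big(\frac{4\tilde\xi}{\tau}-1\Big)\right)=-2-4\left(\sqrt{\Big(\frac{4\tilde\xi}{\tau}\Big)^2-\frac{4\tilde\xi}{\tau}}-\frac{4\tilde\xi}{\tau}\right)\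 \ge\ 0 .$$
   Context: Setting: on a filtered probability space with (risk-neutral) measure $\mathbb P$ and filtration $(\mathcal F_t)_{t\ge0}$, $S_t>0$ is a price process with $d\log S_t=(r-\tfrac12\sigma_t^2)\,dt+\sigma_t\,dW_t$, where $r\ge0$ is a constant, $W$ is an $(\mathcal F_t)$-Brownian motion, $\sigma_t$ is an $(\mathcal F_t)$-adapted process that is right continuous with left-hand limits (non-anticipative of $W$), and $S_0$ is $\mathcal F_0$-measurable. Notation: $\mathbb E_t=\mathbb E[\,\cdot\,|\mathcal F_t]$; an expectation without subscript means $\mathbb E=\mathbb E_0$; $B_{t,T}=e^{-r(T-t)}$. Quantities such as $\tilde\xi,\tilde q,\tilde p$ are computed conditionally on $\mathcal F_t$. The constant $\tau>0$ is the VIX horizon (30 days), and $$\mathrm{VIX}_t=\sqrt{-\tfrac2\tau\,\mathbb E_t\log\big(S_{t+\tau}/\mathbb E_tS_{t+\tau}\big)}.$$ Implied volatility: for maturity $T>t$ and strike $K>0$, the put price is $P(t,K,T)=B_{t,T}\,\mathbb E_t(K-S_T)^+$, and $\hat\sigma(t,K,T)$ is the unique volatility such that $$P(t,K,T)=B_{t,T}\big(\Phi(-d_-)K-\Phi(-d_+)\,\mathbb E_tS_T\big),\qquad d_\pm=\frac{\log(\mathbb E_tS_T/K)}{\hat\sigma(t,K,T)\sqrt{T-t}}\pm\frac{\hat\sigma(t,K,T)\sqrt{T-t}}{2},$$ where $\Phi$ is the standard normal CDF.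
   Formalization: Part 2 is stated under the additional assumption ξ̃ > 0: when ξ̃ = 0 its moment hypothesis is void and its conclusion 4ξ̃/τ ≥ 1 is false, so the printed claim fails there. *)

(* Defs.v *)
From HB Require Import structures.
From mathcomp Require Export all_boot all_order all_algebra.
From mathcomp Require Export all_classical all_reals all_analysis measurable_realfun.
Export Order.TTheory GRing.Theory Num.Theory.
Export numFieldNormedType.Exports.

Set Implicit Arguments.
Unset Strict Implicit.
Unset Printing Implicit Defensive.

Local Open Scope classical_set_scope.
Local Open Scope ring_scope.

(* Time is the type R; every condition below only constrains times >= 0. *)

Section Conditioning.
Context {R : realType} {d : measure_display} {Omega : measurableType d}.
Variable P : probability Omega R.

Definition sub_measurable (G : set_system Omega) {d' : measure_display}
    {E : measurableType d'} (X : Omega -> E) : Prop :=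
  forall B, measurable B -> G (X @^-1` B).

(* Y is a version of E[X | G] for X >= 0; both may take the value +oo, and X
   need not be integrable. *)
Definition is_cond_exp_ge0 (G : set_system Omega) (X Y : Omega -> \bar R) : Prop :=
  [/\ sub_measurable G Y,
      (forall w, 0 <= Y w)%E &
      forall A, G A -> (\int[P]_(w in A) Y w = \int[P]_(w in A) X w)%E].

(* Y is a version of E[X | G] := E[X^+ | G] - E[X^- | G], both terms being
   a.s. finite.  X need not be integrable: with S_0 random, log S_u need not
   be, whereas its increments are integrable conditionally on F_0. *)
Definition is_cond_exp (G : set_system Omega) (X Y : Omega -> R) : Prop :=
  sub_measurable G Y /\
  exists Yp Yn : Omega -> R,
    [/\ is_cond_exp_ge0 G (EFin \o (X ^\+)) (EFin \o Yp),
        is_cond_exp_ge0 G (EFin \o (X ^\-)) (EFin \o Yn) &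
        {ae P, forall w, Y w = Yp w - Yn w}].

(* k w is a regular version of the conditional law of X given G, so that
   E[f(X) | G](w) is the integral of f against k w, simultaneously for all f.
   On R such a version exists and is unique up to a P-null set of w. *)
Definition is_cond_law (G : set_system Omega) (X : Omega -> R)
    (k : Omega -> probability (measurableTypeR R) R) : Prop :=
  forall B : set R, measurable B ->
    sub_measurable G (fun w => k w B) /\
    forall A, G A -> (\int[P]_(w in A) k w B = P (A `&` X @^-1` B))%E.

Definition cvg_in_prob (X : nat -> Omega -> R) (Y : Omega -> R) : Prop :=
  forall e : R, 0 < e ->
    P [set w | e <= `|X n w - Y w|] @[n --> \oo] --> 0%E.

End Conditioning.

Section Processes.
Context {R : realType} {d : measure_display} {Omega : measurableType d}.
Variable P : probability Omega R.
Variable F : R -> set_system Omega.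

Definition filtration : Prop :=
  [/\ forall u : R, 0 <= u -> sigma_algebra setT (F u),
      forall u : R, 0 <= u -> F u `<=` measurable &
      forall s u : R, 0 <= s -> s <= u -> F s `<=` F u].

Definition adapted (X : R -> Omega -> R) : Prop :=
  forall u : R, 0 <= u -> sub_measurable (F u) (X u).

Definition continuous_path (x : R -> R) : Prop := {within `[0, +oo[, continuous x}.

Definition cadlag_path (x : R -> R) : Prop :=
  (forall u : R, 0 <= u -> x v @[v --> u^'+] --> x u) /\
  (forall u : R, 0 < u -> cvg (x v @[v --> u^'-])).

Definition increment (W : R -> Omega -> R) (s u : R) (w : Omega) : R := W u w - W s w.

Definition brownian_motion (W : R -> Omega -> R) : Prop :=
  [/\ adapted W,
      {ae P, forall w, W 0 w = 0 /\ continuous_path (fun u => W u w)},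
      (forall s u : R, 0 <= s -> s < u -> forall B : set R, measurable B ->
         P (increment W s u @^-1` B) = normal_prob 0 (Num.sqrt (u - s)) B) &
      (forall s u : R, 0 <= s -> s < u ->
         forall (A : set Omega) (B : set R), F s A -> measurable B ->
         P (A `&` increment W s u @^-1` B) =
         (P A * P (increment W s u @^-1` B))%E)].

Definition martingale_on (h : R) (M : R -> Omega -> R) : Prop :=
  [/\ forall u : R, 0 <= u <= h -> sub_measurable (F u) (M u),
      forall u : R, 0 <= u <= h -> P.-integrable setT (EFin \o M u) &
      forall s u : R, 0 <= s -> s <= u -> u <= h -> is_cond_exp P (F s) (M u) (M s)].

(* The simple process
     sum_(i < sp_size) sp_val i * 1_{ ]sp_time i, sp_time (i+1)] }. *)
Record simple_process := SimpleProcess {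
  sp_size : nat;
  sp_time : nat -> R;
  sp_val : nat -> Omega -> R }.

Definition is_simple (H : simple_process) : Prop :=
  [/\ 0 <= sp_time H 0,
      forall i, (i < sp_size H)%N -> sp_time H i <= sp_time H i.+1,
      forall i, (i < sp_size H)%N -> sub_measurable (F (sp_time H i)) (sp_val H i) &
      forall i, (i < sp_size H)%N -> exists c, forall w, `|sp_val H i w| <= c].

Definition sp_eval (H : simple_process) (u : R) (w : Omega) : R :=
  \sum_(i < sp_size H)
    sp_val H i w * \1_(`]sp_time H i, sp_time H i.+1]%classic) u.

Definition sp_integral (W : R -> Omega -> R) (H : simple_process) (u : R)
    (w : Omega) : R :=
  \sum_(i < sp_size H) sp_val H i w *
    (W (Num.min (sp_time H i.+1) u) w - W (Num.min (sp_time H i) u) w).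

(* I is the Ito integral of sigma against W: the continuous process that is the
   limit in probability of the integrals of simple processes H n with
   int_0^u (H n - sigma)^2 -> 0 in probability. *)
Definition is_ito_integral (W sigma I : R -> Omega -> R) : Prop :=
  [/\ forall u : R, 0 <= u -> measurable_fun setT (I u),
      {ae P, forall w, continuous_path (fun u => I u w)} &
      exists H : nat -> simple_process, (forall n, is_simple (H n)) /\
        forall u : R, 0 <= u ->
          cvg_in_prob P (fun n w => \int[lebesgue_measure]_(v in `[0, u])
                           (sp_eval (H n) v w - sigma v w) ^+ 2) (fun=> 0) /\
          cvg_in_prob P (fun n => sp_integral W (H n) u) (I u)].

(* d log S_u = (r - sigma_u^2 / 2) du + sigma_u dW_u *)
Definition stoch_vol_model (r : R) (W sigma S : R -> Omega -> R) : Prop :=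
  [/\ brownian_motion W,
      adapted sigma /\ (forall w, cadlag_path (fun u => sigma u w)),
      adapted S,
      (forall (u : R) w, 0 <= u -> 0 < S u w) &
      exists I, is_ito_integral W sigma I /\
        {ae P, forall w, forall u : R, 0 <= u ->
           ln (S u w) = ln (S 0 w)
             + \int[lebesgue_measure]_(v in `[0, u]) (r - sigma v w ^+ 2 / 2)
             + I u w}].

(* E_0 int_0^h sigma_u^2 du < oo a.s., in the form: E[ . | F_0] has a real-valued
   version.  This is weaker than finiteness of the unconditional expectation. *)
Definition finite_expected_variance (h : R) (sigma : R -> Omega -> R) : Prop :=
  exists Y : Omega -> R,
    is_cond_exp_ge0 P (F 0)
      (fun w => \int[lebesgue_measure]_(v in `[0%R, h]) (sigma v w ^+ 2)%:E)%E
      (EFin \o Y).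

(* V is a version of VIX_u (M of E_u S_{u+tau}, L of the log-contract). *)
Definition is_VIX (tau : R) (S : R -> Omega -> R) (u : R) (V : Omega -> R) : Prop :=
  exists M L : Omega -> R,
    [/\ is_cond_exp P (F u) (S (u + tau)) M,
        is_cond_exp P (F u) (fun w => ln (S (u + tau) w / M w)) L &
        forall w, V w = Num.sqrt (- (2 / tau) * L w)].

End Processes.

(* Below, mu stands for the conditional law given F_t, at a fixed scenario, of
   VIX_T or of the price at maturity. *)
Section ConditionalLaw.
Context {R : realType}.
Implicit Types mu : probability (measurableTypeR R) R.

Definition critical_exp_sq mu : \bar R :=
  ereal_sup [set xi%:E | xi in [set xi : R | 0 <= xi /\
    (\int[mu]_v (expR (xi * v ^+ 2))%:E < +oo)%E]].

Definition critical_neg_moment mu : \bar R :=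
  ereal_sup [set q%:E | q in [set q : R | 0 <= q /\
    (\int[mu]_s (s `^ (- q))%:E < +oo)%E]].

Definition critical_pos_moment mu : \bar R :=
  ereal_sup [set p%:E | p in [set p : R | 0 <= p /\
    (\int[mu]_s (s `^ (1 + p))%:E < +oo)%E]].

Definition mean mu : R := \int[mu]_s s.

Definition Phi (x : R) : R := fine (normal_prob 0 1 `]-oo, x]).

Definition put_price mu (r t T K : R) : R :=
  expR (- r * (T - t)) * \int[mu]_s (Num.max (K - s) 0).

Definition black_scholes_put (r t T m K v : R) : R :=
  let dplus := ln (m / K) / (v * Num.sqrt (T - t)) + v * Num.sqrt (T - t) / 2 in
  let dminus := ln (m / K) / (v * Num.sqrt (T - t)) - v * Num.sqrt (T - t) / 2 in
  expR (- r * (T - t)) * (Phi (- dminus) * K - Phi (- dplus) * m).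

(* The Black-Scholes price is strictly increasing in v > 0, so there is at most
   one solution.  If the put is worth its intrinsic value there is none, and the
   value is 0, in accordance with the limit v -> 0+. *)
Definition implied_vol mu (r t T K : R) : R :=
  xget 0 [set v : R | 0 < v /\
    put_price mu r t T K = black_scholes_put r t T (mean mu) K v].

Definition beta_left mu (r t T : R) : \bar R :=
  limf_esup (fun K : R => (implied_vol mu r t T K ^+ 2 /
    (`|ln (K / mean mu)| / (T - t)))%:E) 0^'+.

Definition beta_right mu (r t T : R) : \bar R :=
  limf_esup (fun K : R => (implied_vol mu r t T K ^+ 2 /
    (ln (K / mean mu) / (T - t)))%:E) (pinfty_nbhs R).

End ConditionalLaw.

(* Main.v *)
Require Import Defs.
From mathcomp Require Import ring lra.

(** Let X = S_{T+tau}, Y = S_T, let L be the conditional log-contract and let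
    M = e^{r tau} Y be the forward price.  For q, b > 0 put h = q b / (q + b).
    Conditional Jensen and Young's inequality give, conditionally on F_T,
      exp (- h L) <= E[(X / M)^(-h)] <= E[X^(-q)] + M^b,
    and exp (- h L) is exp ((tau h / 2) VIX^2).  So, given F_t, finiteness of the
    moments E[X^(-q)] and E[Y^b] forces tau h / 2 <= xi, that is
    2 q b <= a (q + b) with a = 4 xi / tau.  Part 1 takes b = max(a, 1), and
    part 2 takes q = a and b = 1 or b = 1 + p; a first moment of Y is available
    because the discounted price is a martingale.

    The bounds on beta are the easy half of Lee's moment formula.  If the total
    implied variance is at most beta |log (K / m)| for extreme strikes, the
    Gaussian tail bound makes the option price decay like a power of K with
    exponent (2 - beta)^2 / (8 beta), hence all moments below that exponent are
    finite; 2 - 4 (sqrt (a^2 + a) - a) is the value of beta for which this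
    exponent equals a. *)

Set Implicit Arguments.
Unset Strict Implicit.

Local Open Scope classical_set_scope.
Local Open Scope ring_scope.

(** * Mixtures of measures *)

Section mixture.
Import HBNNSimple.
Context {R : realType} {d d' : measure_display} {X : measurableType d}
  {Y : measurableType d'}.
Local Open Scope ereal_scope.

Lemma integral_nnsfun_fsbig (m : {measure set Y -> \bar R}) (g : {nnsfun Y >-> R}) :
  \int[m]_y (g y)%:E = \sum_(r \in range g) r%:E * m (g @^-1` [set r]).
Proof. by rewrite integralT_nnsfun sintegralE. Qed.

Lemma nnsfun_coeff_ge0 (m : set Y -> \bar R) (g : {nnsfun Y >-> R}) r :
  m set0 = 0 -> (forall B, 0 <= m B) -> 0 <= r%:E * m (g @^-1` [set r]).
Proof.
move=> m0 mge0; have [r0|r0] := leP 0%R r; first by rewrite mule_ge0// lee_fin.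
by rewrite preimage_nnfun0// m0 mule0.
Qed.

Variables (k : X -> {measure set Y -> \bar R}).
Hypothesis mk : forall B, measurable B -> measurable_fun setT (fun x => k x B).

Lemma measurable_nnsfun_mixture (g : {nnsfun Y >-> R}) :
  measurable_fun setT (fun x => \int[k x]_y (g y)%:E).
Proof.
rewrite [X in measurable_fun _ X](_ : _ = fun x =>
    \sum_(r \in range g) r%:E * k x (g @^-1` [set r])); last first.
  by apply/funext => x; rewrite integral_nnsfun_fsbig.
apply: emeasurable_fsum => // r; apply: measurable_funeM; exact: mk.
Qed.

Variables (f : Y -> \bar R).
Hypothesis f0 : forall y, 0 <= f y.
Hypothesis mf : measurable_fun setT f.

Let f_ := nnsfun_approx measurableT mf.

Let cvg_mixture x : \int[k x]_y (f_ n y)%:E @[n --> \oo] --> \int[k x]_y f y.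
Proof.
have -> : \int[k x]_y f y = \int[k x]_y (limn (fun n => (f_ n y)%:E)).
  apply: eq_integral => y _; apply/esym/cvg_lim => //.
  exact: (cvg_nnsfun_approx measurableT mf).
apply: cvg_monotone_convergence => //.
- by move=> n; exact/measurable_EFinP.
- by move=> n y _; rewrite lee_fin.
- by move=> y _ m n mn; rewrite lee_fin; exact/lefP/nd_nnsfun_approx.
Qed.

Lemma measurable_mixture : measurable_fun setT (fun x => \int[k x]_y f y).
Proof.
apply: (emeasurable_fun_cvg (fun n x => \int[k x]_y (f_ n y)%:E)).
  by move=> n; exact: measurable_nnsfun_mixture.
by move=> x _; exact: cvg_mixture.
Qed.

Variables (mu : {measure set X -> \bar R}) (A : set X).
Hypothesis mA : measurable A.

(** Monotone convergence is applied once under [k x] and once under [mu]. The result involves [k]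
    only through the averages of [k x B] over [A], so two kernels with equal averages on all
    measurable sets can be exchanged. *)
Lemma mixtureE : \int[mu]_(x in A) \int[k x]_y f y =
  limn (fun n => \sum_(r \in range (f_ n))
    r%:E * \int[mu]_(x in A) k x (f_ n @^-1` [set r])).
Proof.
transitivity (limn (fun n => \int[mu]_(x in A) \int[k x]_y (f_ n y)%:E)).
  rewrite -monotone_convergence//.
  - by apply: eq_integral => x _; apply/esym/cvg_lim => //; exact: cvg_mixture.
  - by move=> n; apply: measurable_funTS; exact: measurable_nnsfun_mixture.
  - by move=> n x _; apply: integral_ge0 => y _; rewrite lee_fin.
  - move=> x _ m n mn; apply: ge0_le_integral => //.
    + by move=> y _; rewrite lee_fin.
    + exact/measurable_EFinP.
    + exact/measurable_EFinP.
    + by move=> y _; rewrite lee_fin; exact/lefP/nd_nnsfun_approx.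
congr (limn _); apply/funext => n.
under eq_integral do rewrite integral_nnsfun_fsbig.
rewrite ge0_integral_fsum//; last 2 first.
- by move=> r; apply: measurable_funTS; apply: measurable_funeM; exact: mk.
- by move=> r x _; exact: nnsfun_coeff_ge0.
apply: eq_fsbigr => r _.
(* A negative [r] is not a value of the nonnegative function [f_ n], so its preimage is empty and
   the term vanishes. *)
have [r0|r0] := leP 0%R r.
  by rewrite ge0_integralZl//; apply: measurable_funTS; exact: mk.
rewrite !preimage_nnfun0//; under eq_integral do rewrite measure0 mule0.
by under [in RHS]eq_integral do rewrite measure0; rewrite !integral0 mule0.
Qed.

End mixture.

Section eq_mixture.
Import HBNNSimple.

(* Covers both disintegration (k x a conditional law, k' x a Dirac mass) and
   pulling a factor out of a conditional expectation (weighted Dirac masses). *)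
Lemma eq_mixture {R : realType} {d d'} {X : measurableType d} {Y : measurableType d'}
    (mu : {measure set X -> \bar R}) (k k' : X -> {measure set Y -> \bar R})
    (A : set X) (f : Y -> \bar R) :
  (forall B, measurable B -> measurable_fun setT (fun x => k x B)) ->
  (forall B, measurable B -> measurable_fun setT (fun x => k' x B)) ->
  measurable A -> measurable_fun setT f -> (forall y, 0 <= f y)%E ->
  (forall B, measurable B -> \int[mu]_(x in A) k x B = \int[mu]_(x in A) k' x B)%E ->
  (\int[mu]_(x in A) \int[k x]_y f y = \int[mu]_(x in A) \int[k' x]_y f y)%E.
Proof.
move=> mk mk' mA mf f0 kk'; rewrite (mixtureE mk f0 mf)// (mixtureE mk' f0 mf)//.
congr (limn _); apply/funext => n; apply: eq_fsbigr => r _.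
by rewrite kk'.
Qed.

End eq_mixture.

(** * Conditional expectations and conditional laws *)

Section conditioning.
Context {R : realType} {d : measure_display} {Omega : measurableType d}.
Variables (P : probability Omega R) (G : set_system Omega).
Hypothesis sG : sigma_algebra setT G.
Hypothesis Gm : G `<=` measurable.

(** The same outcomes with [G] as the family of measurable sets, so that closure properties of
    measurable functions become closure properties of [sub_measurable G]. *)
Local Notation OmegaG := (g_sigma_algebraType G).
Local Open Scope ereal_scope.

Lemma sub_measurableP {d'} {E : measurableType d'} (X : Omega -> E) :
  sub_measurable G X <-> measurable_fun setT (X : OmegaG -> E).
Proof.
split=> [GX _ B mB|mX B mB].
  by rewrite setTI measurable_g_measurableTypeE//; exact: GX.
have := mX measurableT B mB.
by rewrite setTI measurable_g_measurableTypeE.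
Qed.

Lemma sub_measurable_measurable {d'} {E : measurableType d'} (X : Omega -> E) :
  sub_measurable G X -> measurable_fun setT X.
Proof. by move=> GX _ B mB; rewrite setTI; apply: Gm; exact: GX. Qed.

Lemma measurableG (A : set OmegaG) : measurable A -> G A.
Proof. by rewrite measurable_g_measurableTypeE. Qed.

Lemma measurable_mscale_dirac (f : Omega -> R) (f0 : forall w, (0 <= f w)%R) B :
  measurable_fun setT f -> measurable B ->
  measurable_fun setT (fun w => mscale (NngNum (f0 w)) \d_w B : \bar R).
Proof.
move=> mf mB; rewrite /mscale/= /dirac; apply/measurable_EFinP => /=.
by apply: measurable_funM => //; exact: measurable_indic.
Qed.

(** Dirac masses at [w] weighted by [X w] and by [Y w] have equal averages over [A] on every [B] in
    [G], because [A] intersected with [B] is again in [G]. Then [eq_mixture] extends the equality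
    from indicators to [g]. *)
Lemma cond_exp_pull_out (X Y : Omega -> R) (g : Omega -> \bar R) (A : set Omega) :
  measurable_fun setT X -> (forall w, (0 <= X w)%R) ->
  is_cond_exp_ge0 P G (EFin \o X) (EFin \o Y) ->
  sub_measurable G g -> (forall w, 0 <= g w) -> G A ->
  \int[P]_(w in A) ((Y w)%:E * g w) = \int[P]_(w in A) ((X w)%:E * g w).
Proof.
move=> mX X0 [GY Y0 GXY] Gg g0 GA.
have {}Y0 w : (0 <= Y w)%R by rewrite -lee_fin; exact: Y0.
have mY : measurable_fun setT Y.
  by apply/measurable_EFinP; exact: sub_measurable_measurable.
have mg : measurable_fun setT (g : OmegaG -> \bar R) by exact/sub_measurableP.
pose k (f : Omega -> R) (f0 : forall w, (0 <= f w)%R) (w : Omega) :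
  {measure set OmegaG -> \bar R} := mscale (NngNum (f0 w)) \d_(w : OmegaG).
have kE f f0 w : \int[k f f0 w]_y g y = (f w)%:E * g w.
  by rewrite /k ge0_integral_mscale// integral_dirac// diracT mul1e.
have mk f f0 : measurable_fun setT f -> forall B, measurable B ->
    measurable_fun setT (fun w => k f f0 w B).
  move=> mf B /measurableG GB.
  by apply: (@measurable_mscale_dirac f f0 B) => //; exact: Gm.
under eq_integral do rewrite -(kE Y Y0).
under [RHS]eq_integral do rewrite -(kE X X0).
apply: (eq_mixture (X := Omega) (Y := OmegaG)) => //.
- exact: mk.
- exact: mk.
- exact: Gm.
move=> B /measurableG GB.
have GAB : G (A `&` B).
  apply: measurableG; apply: measurableI; rewrite measurable_g_measurableTypeE//.
rewrite /k /mscale/= /dirac.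
have h (f : Omega -> R) : \int[P]_(w in A) ((f w)%:E * (\1_B w)%:E) =
    \int[P]_(w in A `&` B) (f w)%:E.
  rewrite integral_mkcondr; apply: eq_integral => w _.
  rewrite patchE indicE; case: ifPn => _; first by rewrite mule1.
  by rewrite mule0.
by rewrite !h; exact: GXY.
Qed.

(** The integrals may be infinite, so the set where [U] exceeds [V] is covered by the sets [A n] on
    which [V] is at most [n] and the excess is at least [1 / (n + 1)]. There the integral of [V] is
    finite and can be cancelled, which forces [P (A n) = 0]. *)
Lemma ae_le_of_integral_le (U V : Omega -> \bar R) :
  sub_measurable G U -> sub_measurable G V ->
  (forall w, 0 <= U w) -> (forall w, 0 <= V w) ->
  (forall A, G A -> \int[P]_(w in A) U w <= \int[P]_(w in A) V w) ->
  {ae P, forall w, U w <= V w}.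
Proof.
move=> GU GV U0 V0 UV.
have mU := sub_measurable_measurable GU.
have mV := sub_measurable_measurable GV.
pose A n := [set w | V w <= n%:R%:E] `&` [set w | V w + n.+1%:R^-1%:E <= U w].
have GA n : G (A n).
  apply: measurableG; apply: measurableI.
    rewrite -[X in measurable X]setTI; apply: measurable_lee => //.
    exact/sub_measurableP.
  rewrite -[X in measurable X]setTI; apply: measurable_lee => //.
    apply: emeasurable_funD => //; exact/sub_measurableP.
  exact/sub_measurableP.
have PA n : P (A n) = 0.
  have mA := Gm (GA n).
  have Vfin : \int[P]_(w in A n) V w < +oo.
    apply: (@le_lt_trans _ _ (\int[P]_(w in A n) n%:R%:E)).
      apply: ge0_le_integral => //; try (by move=> w []); exact: measurable_funTS.
    by rewrite integral_cst// lte_mul_pinfty// (le_lt_trans (probability_le1 P mA))// ltry.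
  have : \int[P]_(w in A n) (V w + n.+1%:R^-1%:E) <= \int[P]_(w in A n) V w.
    apply: le_trans (UV _ (GA n)); apply: ge0_le_integral => //.
    - by move=> w _; rewrite adde_ge0// lee_fin.
    - by apply: measurable_funTS; exact: emeasurable_funD.
    - exact: measurable_funTS.
    - by move=> w [].
  rewrite ge0_integralD//; last exact: measurable_funTS.
  rewrite integral_cst// -[leRHS]adde0 leeD2lE; last first.
    by rewrite ge0_fin_numE//; exact: integral_ge0.
  by rewrite pmule_rle0 ?lte_fin// measure_le0 => /eqP.
have : P.-negligible (\bigcup_n A n).
  by apply: negligible_bigcup => n; exists (A n); split; [exact/Gm/GA|exact: PA|by []].
apply: negligibleS.
move=> w /= /negP; rewrite -ltNge => VU.
have : V w \is a fin_num by rewrite ge0_fin_numE// (lt_le_trans VU)// leey.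
  move: VU; rewrite /A /bigcup/=.
  case: (V w) (V0 w) => // v; rewrite lee_fin => v0 vU _.
  have [e e0 eU] : exists2 e : R, (0 < e)%R & (v + e)%:E <= U w.
    case: (U w) vU => [u|_|//]; last by exists 1%R => //; rewrite leey.
    rewrite lte_fin => vu; exists (u - v)%R; first by rewrite subr_gt0.
    by rewrite addrC subrK.
  have [n [vn en]] : exists n, (v <= n%:R /\ n.+1%:R^-1 <= e)%R.
    near \oo => n; exists n; split; near: n; first exact: nbhs_infty_ger.
    have := near_infty_natSinv_lt (PosNum e0).
    by apply: filterS => n /ltW.
  exists n => //; split; first by rewrite lee_fin.
  by apply: le_trans eU; rewrite -EFinD lee_fin lerD2l.
Unshelve. all: by end_near. Qed.

End conditioning.

(** * Disintegration and a conditional Jensen inequality *)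

Section conditional_law.
Context {R : realType} {d : measure_display} {Omega : measurableType d}.
Variables (P : probability Omega R) (G : set_system Omega).
Hypothesis sG : sigma_algebra setT G.
Hypothesis Gm : G `<=` measurable.
Local Open Scope ereal_scope.

Section law.
Variables (X : Omega -> R) (k : Omega -> probability (measurableTypeR R) R).
Hypothesis mX : measurable_fun setT X.
Hypothesis kX : is_cond_law P G X k.
Variable f : measurableTypeR R -> \bar R.
Hypothesis mf : measurable_fun setT f.
Hypothesis f0 : forall x, 0 <= f x.

Lemma cond_law_integral_measurable : sub_measurable G (fun w => \int[k w]_x f x).
Proof.
apply/sub_measurableP => //.
apply: (@measurable_mixture _ _ _ (g_sigma_algebraType G)) => // B mB.
by apply/sub_measurableP => //; exact: (kX mB).1.
Qed.

(** On sets, [k w] and the Dirac mass at [X w] have the same averages over [A] by definition of the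
    conditional law; [eq_mixture] passes to functions. *)
Lemma cond_law_integral A : G A ->
  \int[P]_(w in A) \int[k w]_x f x = \int[P]_(w in A) f (X w).
Proof.
move=> GA; transitivity (\int[P]_(w in A) \int[\d_(X w : measurableTypeR R)]_x f x).
  apply: eq_mixture => //.
  - by move=> B mB; apply: (sub_measurable_measurable Gm); exact: (kX mB).1.
  - move=> B mB; rewrite /dirac; apply/measurable_EFinP.
    by apply: (measurableT_comp _ mX); exact: measurable_indic.
  - exact: Gm.
  move=> B mB; rewrite (kX mB).2//.
  rewrite /dirac (_ : (fun w => _) = (fun w => (\1_(X @^-1` B) w)%:E)).
    rewrite integral_indic; [by rewrite setIC|exact: Gm|].
    by rewrite -[X in measurable X]setTI; exact: mX.
  by apply/funext => w; rewrite !indicE.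
by apply: eq_integral => w _; rewrite integral_dirac// diracT mul1e.
Qed.

End law.

Section jensen.
Variables (Z L Lp Ln : Omega -> R).
Hypothesis mZ : measurable_fun setT Z.
Hypothesis GL : sub_measurable G L.
Hypothesis ZLp : is_cond_exp_ge0 P G (EFin \o (Z ^\+)%R) (EFin \o Lp).
Hypothesis ZLn : is_cond_exp_ge0 P G (EFin \o (Z ^\-)%R) (EFin \o Ln).
Hypothesis LpLn : {ae P, forall w, L w = (Lp w - Ln w)%R}.
Variable q : R.
Hypothesis q0 : (0 <= q)%R.

Let mL : measurable_fun setT L. Proof. exact: (sub_measurable_measurable Gm). Qed.
Let mLp : measurable_fun setT Lp.
Proof. by apply/measurable_EFinP; apply: (sub_measurable_measurable Gm); case: ZLp. Qed.
Let mLn : measurable_fun setT Ln.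
Proof. by apply/measurable_EFinP; apply: (sub_measurable_measurable Gm); case: ZLn. Qed.
Let mp : measurable_fun setT (Z ^\+)%R.
Proof. exact: measurable_funrpos. Qed.
Let mn : measurable_fun setT (Z ^\-)%R.
Proof. exact: measurable_funrneg. Qed.
Let Lp0 w : (0 <= Lp w)%R. Proof. by case: ZLp => _ + _ => /(_ w). Qed.
Let Ln0 w : (0 <= Ln w)%R. Proof. by case: ZLn => _ + _ => /(_ w). Qed.
Let p0 w : (0 <= (Z ^\+)%R w)%R. Proof. exact: funrpos_ge0. Qed.
Let n0 w : (0 <= (Z ^\-)%R w)%R. Proof. exact: funrneg_ge0. Qed.

Let E w := expR (- q * L w).
(** Truncation: on [D n] the integrals weighted by [E] are finite and can be cancelled. These sets
    belong to [G] and exhaust the space. *)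
Let D n := [set w | [/\ (`|L w| <= n%:R)%R, (Lp w <= n%:R)%R & (Ln w <= n%:R)%R]].

Let GD n : G (D n).
Proof.
have GLp : sub_measurable G (EFin \o Lp) by case: ZLp.
have GLn : sub_measurable G (EFin \o Ln) by case: ZLn.
rewrite (_ : D n = [set w | (`|L w| <= n%:R)%R] `&` [set w | (Lp w)%:E <= n%:R%:E]
   `&` [set w | (Ln w)%:E <= n%:R%:E]); last first.
  by apply/seteqP; split=> w /=; rewrite !lee_fin; [case=> ? ? ?|case=> -[? ?] ?].
apply: (measurableG sG); apply: measurableI; first apply: measurableI.
- rewrite -[X in measurable X]setTI; apply: measurable_fun_le => //.
  by apply: measurableT_comp => //; exact/sub_measurableP.
- rewrite -[X in measurable X]setTI; apply: measurable_lee => //.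
  exact/(sub_measurableP sG (EFin \o Lp)).
- rewrite -[X in measurable X]setTI; apply: measurable_lee => //.
  exact/(sub_measurableP sG (EFin \o Ln)).
Qed.

(** The tangent at [L w] of the convex function [expR (- q * x)] lies below its graph. Splitting [Z]
    and [L] into positive and negative parts and moving every subtracted term across leaves only
    nonnegative terms, whose integrals always make sense. *)
Let tangent w : (L w = Lp w - Ln w)%R ->
  (E w + q * ((Z ^\-)%R w * E w + Lp w * E w) <=
   expR (- q * Z w) + q * ((Z ^\+)%R w * E w + Ln w * E w))%R.
Proof.
move=> Lw; have Zw : Z w = ((Z ^\+)%R w - (Z ^\-)%R w)%R.
  by rewrite -[in LHS](funrposBneg Z).
have -> : expR (- q * Z w) = (E w * expR (- q * (Z w - L w)))%R.
  by rewrite -expRD; congr expR; ring.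
have := expR_ge1Dx (- q * (Z w - L w)).
rewrite -(ler_pM2l (expR_gt0 (- q * L w))) -/(E w) => h.
rewrite -subr_ge0; move: h; rewrite -subr_ge0 => /le_trans; apply.
set ex := expR _; rewrite (_ : Z w - L w = (Z ^\+)%R w - (Z ^\-)%R w - (Lp w - Ln w))%R; last first.
  by rewrite -Lw -Zw.
move: (E w) ex => e ex; rewrite le_eqVlt; apply/orP; left; apply/eqP; ring.
Qed.

Let mE : measurable_fun setT E.
Proof. by apply: measurableT_comp => //; exact: measurable_funM. Qed.

Let GE : sub_measurable G (EFin \o E).
Proof.
apply/sub_measurableP => //; apply/measurable_EFinP; apply: measurableT_comp => //.
by apply: measurable_funM => //; exact/sub_measurableP.
Qed.

(** The tangent inequality is integrated over [B]. Pulling out [E] replaces the positive part of [Z]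
    by [Lp] and the negative part by [Ln]; both sides then carry the same extra term, finite on
    [D n], and it cancels. *)
Let jensen_trunc n A : G A ->
  \int[P]_(w in A `&` D n) (E w)%:E <= \int[P]_(w in A `&` D n) (expR (- q * Z w))%:E.
Proof.
move=> GA; set B := A `&` D n.
have GB : G B.
  apply: (measurableG sG); apply: measurableI; rewrite measurable_g_measurableTypeE//.
have mB : measurable B by exact: Gm.
have E0 w : (0 <= E w)%R by exact: expR_ge0.
have fin (f : Omega -> R) : measurable_fun setT f -> (forall w, (0 <= f w)%R) ->
    (forall w, D n w -> (f w <= n%:R)%R) ->
    \int[P]_(w in B) (f w * E w)%:E \is a fin_num.
  move=> mf f0 fn; rewrite ge0_fin_numE; last first.
    by apply: integral_ge0 => w _; rewrite lee_fin mulr_ge0.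
  apply: (@le_lt_trans _ _ (\int[P]_(w in B) (n%:R * expR (q * n%:R))%:E)).
    apply: ge0_le_integral => //.
    - by move=> w _; rewrite lee_fin mulr_ge0.
    - by apply/measurable_EFinP/measurable_funTS; exact: measurable_funM.
    - move=> w [_ Dw]; rewrite lee_fin ler_pM//; first exact: fn.
      rewrite ler_expR mulNr -mulrN ler_wpM2l//; case: Dw => + _ _.
      by rewrite ler_norml => /andP[+ _]; rewrite lerNl.
  rewrite integral_cst// lte_mul_pinfty// ?lee_fin ?mulr_ge0 ?expR_ge0//.
  by rewrite (le_lt_trans (probability_le1 P mB))// ltry.
have pull (X Y : Omega -> R) : measurable_fun setT X -> (forall w, (0 <= X w)%R) ->
    is_cond_exp_ge0 P G (EFin \o X) (EFin \o Y) ->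
    \int[P]_(w in B) (X w * E w)%:E = \int[P]_(w in B) (Y w * E w)%:E.
  move=> mX X0 XY.
  exact/esym/(cond_exp_pull_out (P := P) sG Gm mX X0 XY GE).
have meas (X : Omega -> R) : measurable_fun setT X ->
    measurable_fun B (fun w => (X w * E w)%:E).
  by move=> mX; apply/measurable_EFinP/measurable_funTS; exact: measurable_funM.
have int2 (X Y W : Omega -> R) : measurable_fun setT X -> measurable_fun setT Y ->
    measurable_fun setT W -> (forall w, (0 <= W w)%R) ->
    (forall w, (0 <= X w)%R) -> (forall w, (0 <= Y w)%R) ->
    \int[P]_(w in B) (W w + q * (X w * E w + Y w * E w))%:E =
    \int[P]_(w in B) (W w)%:E + q%:E * (\int[P]_(w in B) (X w * E w)%:E +
      \int[P]_(w in B) (Y w * E w)%:E).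
  move=> mX mY mW W0 X0 Y0; under eq_integral do rewrite EFinD EFinM EFinD.
  have XE0 w : 0 <= (X w * E w)%:E by rewrite lee_fin mulr_ge0.
  have YE0 w : 0 <= (Y w * E w)%:E by rewrite lee_fin mulr_ge0.
  have mS : measurable_fun B (fun w => (X w * E w)%:E + (Y w * E w)%:E).
    by apply: emeasurable_funD; exact: meas.
  rewrite ge0_integralD//.
  - rewrite ge0_integralZl//; last by move=> w _; exact: adde_ge0.
    by rewrite ge0_integralD//; exact: meas.
  - by move=> w _; rewrite lee_fin.
  - by apply/measurable_EFinP/measurable_funTS.
  - by move=> w _; apply: mule_ge0; [rewrite lee_fin|exact: adde_ge0].
  - exact: measurable_funeM.
have : \int[P]_(w in B) (E w + q * ((Z ^\-)%R w * E w + Lp w * E w))%:E <=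
    \int[P]_(w in B) (expR (- q * Z w) + q * ((Z ^\+)%R w * E w + Ln w * E w))%:E.
  apply: ae_ge0_le_integral => //.
  - by move=> w _; rewrite lee_fin !(addr_ge0, mulr_ge0).
  - apply/measurable_EFinP/measurable_funTS/measurable_funD => //.
    apply: measurable_funM => //; apply: measurable_funD; exact: measurable_funM.
  - by move=> w _; rewrite lee_fin !(addr_ge0, mulr_ge0)// expR_ge0.
  - apply/measurable_EFinP/measurable_funTS/measurable_funD => //.
      by apply: measurableT_comp => //; exact: measurable_funM.
    apply: measurable_funM => //; apply: measurable_funD; exact: measurable_funM.
  - by apply: filterS LpLn => w Lw _; rewrite lee_fin; exact: tangent.
have mexpZ : measurable_fun setT (fun w => expR (- q * Z w)).
  by apply: measurableT_comp => //; exact: measurable_funM.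
have expZ0 w : (0 <= expR (- q * Z w))%R by exact: expR_ge0.
rewrite !int2//.
rewrite (pull _ _ mp p0 ZLp) (pull _ _ mn n0 ZLn) [X in _ + _ * X <= _]addeC leeD2rE//.
rewrite fin_numM// fin_numD !fin//; [by move=> w []|by move=> w []].
Qed.

(** Monotone convergence along the increasing sets [D n] removes the truncation. *)
Lemma cond_jensen_expR A : G A ->
  \int[P]_(w in A) (expR (- q * L w))%:E <= \int[P]_(w in A) (expR (- q * Z w))%:E.
Proof.
move=> GA.
have mA := Gm GA.
have mD n : measurable (D n) by exact/Gm/GD.
have DT : A = \bigcup_n (A `&` D n).
  rewrite -setI_bigcupr; apply/esym/setIidPl => w _.
  near \oo => n; exists n => //; split; near: n; exact: nbhs_infty_ger.
have : \int[P]_(w in A `&` D n) (E w)%:E @[n --> \oo] -->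
    \int[P]_(w in \bigcup_n (A `&` D n)) (E w)%:E.
  apply: (@ge0_nondecreasing_set_cvg_integral _ _ _ (fun n => A `&` D n)).
  - move=> i j ij; apply/subsetPset; apply: setIS => w [a b c].
    by split; [apply: le_trans a _|apply: le_trans b _|apply: le_trans c _];
      rewrite ler_nat.
  - by move=> n; exact: measurableI.
  - by move=> n; exact/measurable_EFinP/measurable_funTS.
  - by move=> n w _; rewrite lee_fin expR_ge0.
rewrite -DT => /cvge_to_le; apply.
apply: nearW => n /=; apply: le_trans (jensen_trunc n GA) _.
apply: ge0_subset_integral => //.
+ exact: measurableI.
+ apply/measurable_EFinP/measurable_funTS; apply: measurableT_comp => //.
  exact: measurable_funM.
Unshelve. all: by end_near. Qed.

End jensen.
End conditional_law.

(** * Uniqueness of conditional expectations; support and integrability of conditional laws *)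

Section cond_exp_unique.
Context {R : realType} {d : measure_display} {Omega : measurableType d}.
Variables (P : probability Omega R) (G : set_system Omega).
Hypothesis sG : sigma_algebra setT G.
Hypothesis Gm : G `<=` measurable.

Lemma cond_exp_ge0Z_unique (c : R) (X X' Y Y' : Omega -> R) : 0 <= c ->
  measurable_fun setT X -> (forall w, 0 <= X w) -> (forall w, X' w = c * X w) ->
  is_cond_exp_ge0 P G (EFin \o X) (EFin \o Y) ->
  is_cond_exp_ge0 P G (EFin \o X') (EFin \o Y') ->
  {ae P, forall w, Y' w = c * Y w}.
Proof.
move=> c0 mX X0 X'X [GY Y0 XY] [GY' Y'0 X'Y'].
have mY := sub_measurable_measurable Gm GY.
have GcY : sub_measurable G (fun w => c%:E * (EFin \o Y) w)%E.
  apply/sub_measurableP => //; apply: measurable_funeM; exact/sub_measurableP.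
have cY0 w : (0 <= c%:E * (EFin \o Y) w)%E by rewrite mule_ge0.
have E A : G A -> (\int[P]_(w in A) (EFin \o Y') w =
    \int[P]_(w in A) (c%:E * (EFin \o Y) w))%E.
  move=> GA; have mA := Gm GA; rewrite X'Y'//.
  rewrite ge0_integralZl//; last exact: measurable_funTS.
  rewrite XY// -ge0_integralZl//; first by apply: eq_integral => w _ /=; rewrite X'X.
  - exact/measurable_EFinP/measurable_funTS.
  - by move=> w _; rewrite lee_fin.
have h1 : {ae P, forall w, ((EFin \o Y') w <= c%:E * (EFin \o Y) w)%E}.
  by apply: (ae_le_of_integral_le sG Gm) => // A GA; rewrite E.
have h2 : {ae P, forall w, (c%:E * (EFin \o Y) w <= (EFin \o Y') w)%E}.
  by apply: (ae_le_of_integral_le sG Gm) => // A GA; rewrite E.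
apply: filterS2 h1 h2 => w /= h1 h2.
by apply/eqP; rewrite eq_le -!lee_fin EFinM h1.
Qed.

(** A factor [c >= 0] commutes with taking positive and negative parts, so the nonnegative case
    applies to each part. *)
Lemma cond_expZ_unique (c : R) (X X' Y Y' : Omega -> R) : 0 <= c ->
  measurable_fun setT X -> (forall w, X' w = c * X w) ->
  is_cond_exp P G X Y -> is_cond_exp P G X' Y' ->
  {ae P, forall w, Y' w = c * Y w}.
Proof.
move=> c0 mX X'X [_ [Yp [Yn [XYp XYn Ypn]]]] [_ [Yp' [Yn' [XYp' XYn' Ypn']]]].
have hp : {ae P, forall w, Yp' w = c * Yp w}.
  apply: (cond_exp_ge0Z_unique c0 _ _ _ XYp XYp') => //; first exact: measurable_funrpos.
  by move=> w; rewrite /funrpos/= X'X maxr_pMr// mulr0.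
have hn : {ae P, forall w, Yn' w = c * Yn w}.
  apply: (cond_exp_ge0Z_unique c0 _ _ _ XYn XYn') => //; first exact: measurable_funrneg.
  by move=> w; rewrite /funrneg/= X'X -mulrN maxr_pMr// mulr0.
apply: filterS2 (filterI Ypn Ypn') (filterI hp hn) => w [-> ->] [-> ->].
by rewrite mulrBr.
Qed.

Variables (X : Omega -> R) (k : Omega -> probability (measurableTypeR R) R).
Hypothesis mX : measurable_fun setT X.
Hypothesis kX : is_cond_law P G X k.

Lemma cond_law_null (B : set R) : measurable B -> (forall w, ~ B (X w)) ->
  {ae P, forall w, k w B = 0%E}.
Proof.
move=> mB XB; have [GkB kB] := kX mB.
have : {ae P, forall w, (k w B <= cst 0 w)%E}.
  apply: (ae_le_of_integral_le sG Gm) => //.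
    by apply/sub_measurableP => //; exact: measurable_cst.
  move=> A GA; rewrite kB// integral0.
  rewrite (_ : _ `&` _ = set0) ?measure0//.
  by apply/seteqP; split => // w [_ /XB].
by apply: filterS => w /=; rewrite measure_le0 => /eqP.
Qed.

(** The first absolute moment of [k w], integrated over [w], is the expectation of [|X|]; being
    finite on average, it is finite almost surely. *)
Lemma cond_law_integrable : P.-integrable setT (EFin \o X) ->
  {ae P, forall w, (k w).-integrable setT EFin}.
Proof.
move=> iX.
pose f (x : measurableTypeR R) : \bar R := `|x%:E|%E.
have mf : measurable_fun setT f by exact: measurableT_comp.
have f0 x : (0 <= f x)%E by exact: abse_ge0.
have GT : G setT by rewrite -(measurable_g_measurableTypeE sG); exact: measurableT.
have mI := sub_measurable_measurable Gm (cond_law_integral_measurable sG kX mf f0).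
have : {ae P, forall w, setT w -> (\int[k w]_x f x \is a fin_num)%E}.
  apply: integrable_ae => //; apply/integrableP; split => //.
  under eq_integral do rewrite gee0_abs ?integral_ge0//.
  rewrite (cond_law_integral Gm mX kX mf f0 GT) /f.
  by move/integrableP : iX => [].
apply: filterS => w /(_ I) fin; apply/integrableP; split => //.
by rewrite ltey_eq fin.
Qed.

End cond_exp_unique.

Section cond_law_le.
Context {R : realType} {d : measure_display} {Omega : measurableType d}.
Variables (P : probability Omega R) (G : set_system Omega).
Hypothesis sG : sigma_algebra setT G.
Hypothesis Gm : G `<=` measurable.
Local Open Scope ereal_scope.

(** This turns an inequality between expectations over the sets of [G] into one between conditional
    laws at almost every scenario: both sides are disintegrated and compared by
    [ae_le_of_integral_le]. *)
Lemma cond_law_integral_leD (V X Y : Omega -> R)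
    (kV kX kY : Omega -> probability (measurableTypeR R) R)
    (f g h : measurableTypeR R -> \bar R) :
  measurable_fun setT V -> measurable_fun setT X -> measurable_fun setT Y ->
  is_cond_law P G V kV -> is_cond_law P G X kX -> is_cond_law P G Y kY ->
  measurable_fun setT f -> measurable_fun setT g -> measurable_fun setT h ->
  (forall x, 0 <= f x) -> (forall x, 0 <= g x) -> (forall x, 0 <= h x) ->
  (forall A, G A -> \int[P]_(w in A) f (V w) <= \int[P]_(w in A) (g (X w) + h (Y w))) ->
  {ae P, forall w, \int[kV w]_x f x <= \int[kX w]_x g x + \int[kY w]_x h x}.
Proof.
move=> mV mX mY lV lX lY mf mg mh f0 g0 h0 le.
have GX := cond_law_integral_measurable sG lX mg g0.
have GY := cond_law_integral_measurable sG lY mh h0.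
apply: (ae_le_of_integral_le sG Gm).
- exact: (cond_law_integral_measurable sG lV).
- by apply/sub_measurableP => //; apply: emeasurable_funD; exact/sub_measurableP.
- by move=> w; exact: integral_ge0.
- by move=> w; apply: adde_ge0; exact: integral_ge0.
move=> A GA; have mA := Gm GA.
rewrite (cond_law_integral Gm mV lV mf f0 GA).
rewrite ge0_integralD//; last 4 first.
- by move=> w _; exact: integral_ge0.
- by apply: measurable_funTS; exact: (sub_measurable_measurable Gm).
- by move=> w _; exact: integral_ge0.
- by apply: measurable_funTS; exact: (sub_measurable_measurable Gm).
rewrite (cond_law_integral Gm mX lX mg g0 GA) (cond_law_integral Gm mY lY mh h0 GA).
rewrite -ge0_integralD//.
- exact: le.
- by apply: measurable_funTS; exact: (measurableT_comp mg mX).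
- by apply: measurable_funTS; exact: (measurableT_comp mh mY).
Qed.

End cond_law_le.

(** * Exponential moments of the squared VIX *)

Section powR_bounds.
Context {R : realType}.
Implicit Types x y m p q s b : R.

Lemma powR_le1D y p s : 0 <= p -> p <= s -> y `^ p <= 1 + y `^ s.
Proof.
move=> p0 ps; have s0 := powR_ge0 y s.
have [y1|y1] := leP y 1; last first.
  by rewrite (le_trans (ler_powR (ltW y1) ps))// lerDr.
apply: (@le_trans _ _ 1); last by rewrite lerDl.
(* A power of a negative base is 1, because [ln] is 0 there. *)
have [y0|y0] := leP 0 y; last by rewrite lt0_powR1.
apply: (@le_trans _ _ (1 `^ p)); last by rewrite powR1.
by apply: ge0_ler_powR; rewrite ?nnegrE.
Qed.

Lemma powRN_le1D y p s : 0 <= p -> p <= s -> y `^ (- p) <= 1 + y `^ (- s).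
Proof.
move=> p0 ps; rewrite -(mulN1r p) -(mulN1r s) !powRrM; exact: powR_le1D.
Qed.

(** Inversion jumps at 0, so it is written through the powers [- 1] of the positive and negative
    parts; both conventions give 0 at 0. *)
Lemma measurable_invr : measurable_fun setT (@GRing.inv R).
Proof.
have -> : @GRing.inv R =
    (fun x => Num.max x 0 `^ (- 1) - Num.max (- x) 0 `^ (- 1)).
  apply/funext => x; have p0 : 0 `^ (- 1) = 0 :> R by rewrite powR0// oppr_eq0 oner_eq0.
  have [x0|x0|->] := ltgtP x 0; last by rewrite oppr0 maxxx p0 subrr invr0.
    rewrite (max_l (_ : 0 <= - x)) ?oppr_ge0 ?ltW// p0 sub0r.
    by rewrite powR_inv1 ?oppr_ge0 ?ltW// invrN opprK.
  rewrite (max_r (_ : - x <= 0)) ?oppr_le0 ?ltW// p0 subr0.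
  by rewrite powR_inv1// ltW.
apply: measurable_funB; apply: (measurableT_comp (measurable_powR _)).
  exact: measurable_maxr.
by apply: measurable_maxr => //; exact: measurable_oppr.
Qed.

(* With weights b / (q + b) and q / (q + b) the left-hand side is a geometric
   mean of the two terms on the right. *)
Lemma expR_young x m q b : 0 < x -> 0 < m -> 0 < q -> 0 < b ->
  expR (- (q * b / (q + b)) * ln (x / m)) <= x `^ (- q) + m `^ b.
Proof.
move=> x0 m0 q0 b0; have qb0 : 0 < q + b by rewrite addr_gt0.
rewrite /powR (gt_eqF x0) (gt_eqF m0) ln_div ?posrE//.
have -> : - (q * b / (q + b)) * (ln x - ln m) =
    b / (q + b) * (- q * ln x) + q / (q + b) * (b * ln m).
  by field; rewrite gt_eqF.
have w1 : b / (q + b) + q / (q + b) = 1 by field; rewrite gt_eqF.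
have wb : 0 < b / (q + b) by rewrite divr_gt0.
have wq : 0 < q / (q + b) by rewrite divr_gt0.
move: (- q * ln x) (b * ln m) => u v.
move: (b / (q + b)) (q / (q + b)) w1 wb wq => c c' w1 wb wq.
have [uv|/ltW uv] := leP u v.
  apply: (@le_trans _ _ (expR v)); last by rewrite lerDr expR_ge0.
  by rewrite ler_expR; nra.
apply: (@le_trans _ _ (expR u)); last by rewrite lerDl expR_ge0.
by rewrite ler_expR; nra.
Qed.

End powR_bounds.

Lemma critical_exp_sq_ge0 {R : realType} (mu : probability (measurableTypeR R) R) :
  (0 <= critical_exp_sq mu)%E.
Proof.
apply: ereal_sup_ubound; exists 0 => //; split => //.
under eq_integral do rewrite mul0r expR0.
by rewrite integral_cst// mul1e (le_lt_trans (probability_le1 _ _))// ltry.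
Qed.

(** * The squared VIX controlled by moments of the price *)

Section vix.
Context {R : realType} {d : measure_display} {Omega : measurableType d}.
Variables (P : probability Omega R) (F : R -> set_system Omega).
Variables (r tau t T : R) (S : R -> Omega -> R) (V : Omega -> R).
Variables lawV lawY lawX : Omega -> probability (measurableTypeR R) R.
Hypotheses (tau_gt0 : 0 < tau) (t_ge0 : 0 <= t) (tT : t < T).
Hypotheses (filF : filtration F) (adS : adapted F S).
Hypothesis S_gt0 : forall u w, 0 <= u -> 0 < S u w.
Hypothesis martS : martingale_on P F (T + tau) (fun u w => S u w * expR (- r * u)).
Hypothesis vixV : is_VIX P F tau S T V.
Hypothesis condV : is_cond_law P (F t) V lawV.
Hypothesis condY : is_cond_law P (F t) (S T) lawY.
Hypothesis condX : is_cond_law P (F t) (S (T + tau)) lawX.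

Let T_ge0 : 0 <= T. Proof. exact: le_trans (ltW tT). Qed.
Let Ttau_ge0 : 0 <= T + tau. Proof. by rewrite addr_ge0// ltW. Qed.
Let sT : sigma_algebra setT (F T). Proof. by case: filF => + _ _; apply. Qed.
Let subT : F T `<=` measurable. Proof. by case: filF => _ + _; apply. Qed.
Let st : sigma_algebra setT (F t). Proof. by case: filF => + _ _; apply. Qed.
Let subt : F t `<=` measurable. Proof. by case: filF => _ + _; apply. Qed.
Let FtT : F t `<=` F T. Proof. by case: filF => _ _; apply => //; exact: ltW. Qed.
Let mY : measurable_fun setT (S T).
Proof. exact: (sub_measurable_measurable subT (adS T_ge0)). Qed.
Let mX : measurable_fun setT (S (T + tau)).
Proof.
case: filF => _ + _ => /(_ _ Ttau_ge0) sub.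
exact: (sub_measurable_measurable sub (adS Ttau_ge0)).
Qed.
Let X0 w : 0 < S (T + tau) w. Proof. exact: S_gt0. Qed.
Let Y0 w : 0 < S T w. Proof. exact: S_gt0. Qed.

(** By the martingale property, [S T * expR (- r * T)] is a conditional expectation of
    [S (T + tau) * expR (- r * (T + tau))]. Uniqueness compares it with the rescaled [M]. *)
Lemma forward_price M : is_cond_exp P (F T) (S (T + tau)) M ->
  {ae P, forall w, M w = expR (r * tau) * S T w}.
Proof.
move=> XM; have [_ _ mart] := martS.
have TTtau : T <= T + tau by rewrite lerDl ltW.
have := cond_expZ_unique sT subT (expR_ge0 (- r * (T + tau))) mX _ XM
  (mart _ _ T_ge0 TTtau (lexx _)).
move=> /(_ (fun w => mulrC _ _)); apply: filterS => w h.
apply: (mulfI (lt0r_neq0 (expR_gt0 (- r * (T + tau))))); rewrite -h mulrA -expRD mulrC.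
by congr (expR _ * _); ring.
Qed.

(** Half the harmonic mean of [q] and [b], times the factor [tau / 2] that undoes the [2 / tau] in
    the squared VIX. *)
Definition mix_exponent (q b : R) := tau / 2 * (q * b / (q + b)).

Lemma mix_exponent_ge0 q b : 0 < q -> 0 < b -> 0 <= mix_exponent q b.
Proof.
move=> q0 b0; rewrite /mix_exponent mulr_ge0//; first by rewrite divr_ge0// ltW.
by rewrite divr_ge0// ltW// ?mulr_gt0 ?addr_gt0.
Qed.

Lemma VIX_measurable : measurable_fun setT V.
Proof.
have [M [L [_ [GL _] VL]]] := vixV.
have -> : V = (fun w => Num.sqrt (- (2 / tau) * L w)) by apply/funext.
apply: (@measurableT_comp _ _ _ _ _ _ (@Num.sqrt R)).
  by apply: continuous_measurable_fun; exact: sqrt_continuous.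
by apply: measurable_funM => //; exact: (sub_measurable_measurable subT).
Qed.

Lemma expR_VIX_le q b A : 0 < q -> 0 < b -> F T A ->
  (\int[P]_(w in A) (expR (mix_exponent q b * V w ^+ 2))%:E <=
   \int[P]_(w in A) ((1 + S (T + tau) w `^ (- q))%:E +
     (expR (r * tau) `^ b * S T w `^ b)%:E))%E.
Proof.
move=> q0 b0 FA; have mA := subT FA.
have [M [L [XM [GL [Lp [Ln [XLp XLn LpLn]]]] VL]]] := vixV.
have GM : sub_measurable (F T) M by case: XM.
have mM := sub_measurable_measurable subT GM.
have mL := sub_measurable_measurable subT GL.
have mZ : measurable_fun setT (fun w => ln (S (T + tau) w / M w)).
  apply: measurableT_comp => //; apply: measurable_funM => //.
  exact: (measurableT_comp measurable_invr mM).
pose h := q * b / (q + b).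
have h0 : 0 <= h by rewrite divr_ge0 ?mulr_ge0 ?addr_ge0// ltW.
have mexp (f : Omega -> R) : measurable_fun setT f ->
    measurable_fun A (fun w => (expR (- h * f w))%:E).
  move=> mf; apply/measurable_EFinP/measurable_funTS.
  by apply: measurableT_comp => //; exact: measurable_funM.
apply: (@le_trans _ _ (\int[P]_(w in A) (1%:E + (expR (- h * L w))%:E))%E).
  apply: ge0_le_integral => //.
  - apply/measurable_EFinP/measurable_funTS; apply: measurableT_comp => //.
    by apply: measurable_funM => //; apply: measurable_funX; exact: VIX_measurable.
  - by apply: emeasurable_funD => //; exact: mexp.
  move=> w _; rewrite -EFinD lee_fin VL.
  (* The chosen version [L] may be positive at some scenarios. The square root is then 0 and the
     exponential is 1, which the added constant 1 absorbs. *)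
  have [L0|L0] := leP 0 (- (2 / tau) * L w).
    rewrite sqr_sqrtr// (_ : mix_exponent q b * _ = - h * L w) ?lerDr//.
    by rewrite /mix_exponent -/h; field; rewrite gt_eqF.
  rewrite ler0_sqrtr; last exact: ltW.
  by rewrite expr0n/= mulr0 expR0 lerDl expR_ge0.
have eA (f : Omega -> R) : measurable_fun setT f ->
   (\int[P]_(w in A) (1%:E + (expR (- h * f w))%:E) =
    \int[P]_(w in A) 1%:E + \int[P]_(w in A) (expR (- h * f w))%:E)%E.
  by move=> mf; rewrite ge0_integralD//; exact: mexp.
rewrite eA//.
apply: (@le_trans _ _ (\int[P]_(w in A)
    (1%:E + (expR (- h * ln (S (T + tau) w / M w)))%:E))%E).
  rewrite eA//; apply: leeD => //.
  exact: (cond_jensen_expR sT subT mZ GL XLp XLn LpLn).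
apply: ae_ge0_le_integral => //.
- by move=> w _; rewrite -EFinD lee_fin addr_ge0 ?expR_ge0.
- by apply: emeasurable_funD => //; exact: mexp.
- by move=> w _; rewrite -EFinD lee_fin !addr_ge0 ?mulr_ge0 ?powR_ge0.
- apply: emeasurable_funD; apply/measurable_EFinP/measurable_funTS.
    by apply: measurable_funD => //; exact: (measurableT_comp (measurable_powR _) mX).
  by apply: measurable_funM => //; exact: (measurableT_comp (measurable_powR _) mY).
apply: filterS (forward_price XM) => w Mw _.
rewrite -!EFinD lee_fin -addrA lerD2l Mw -powRM ?expR_ge0//; last exact: ltW.
by apply: expR_young => //; rewrite mulr_gt0 ?expR_gt0.
Qed.

Lemma cond_expR_VIX_le q b : 0 < q -> 0 < b ->
  {ae P, forall w, (\int[lawV w]_v (expR (mix_exponent q b * v ^+ 2))%:E <=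
    \int[lawX w]_x (1 + x `^ (- q))%:E +
    \int[lawY w]_y (expR (r * tau) `^ b * y `^ b)%:E)%E}.
Proof.
move=> q0 b0.
apply: (cond_law_integral_leD st subt VIX_measurable mX mY condV condX condY).
- apply/measurable_EFinP; apply: measurableT_comp => //.
  by apply: measurable_funM => //; exact: measurable_funX.
- by apply/measurable_EFinP/measurable_funD => //; exact: measurable_powR.
- by apply/measurable_EFinP/measurable_funM => //; exact: measurable_powR.
- by move=> x; rewrite lee_fin expR_ge0.
- by move=> x; rewrite lee_fin addr_ge0 ?powR_ge0.
- by move=> x; rewrite lee_fin mulr_ge0 ?powR_ge0.
- by move=> A FA; apply: expR_VIX_le => //; exact: FtT.
Qed.

Let ge0_integralD_lty (mu : probability (measurableTypeR R) R) (f g : R -> R) c :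
  measurable_fun setT f -> measurable_fun setT g ->
  (forall x, 0 <= f x) -> (forall x, 0 <= g x) -> 0 <= c ->
  (forall x, g x <= c + f x) ->
  (\int[mu]_x (f x)%:E < +oo -> \int[mu]_x (g x)%:E < +oo)%E.
Proof.
move=> mf mg f0 g0 c0 gcf foo.
apply: (@le_lt_trans _ _ (\int[mu]_x (c%:E + (f x)%:E))%E).
  apply: ge0_le_integral => //.
  - by move=> x _; rewrite lee_fin.
  - exact/measurable_EFinP.
  - by apply: emeasurable_funD => //; exact/measurable_EFinP.
  - by move=> x _; rewrite -EFinD lee_fin.
rewrite ge0_integralD//; last exact/measurable_EFinP; last first.
  by move=> x _; rewrite lee_fin.
rewrite integral_cst// lte_add_pinfty//.
rewrite lte_mul_pinfty//; apply: (@le_lt_trans _ _ 1%E); last exact: ltry.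
exact: probability_le1.
Qed.

(* The exponents q and b are allowed to depend on the scenario, so the null
   set has to be chosen uniformly; rational exponents suffice. *)
Lemma critical_exp_sq_VIX_ge : {ae P, forall w, forall q b, 0 < q -> 0 < b ->
  (\int[lawX w]_x (x `^ (- q))%:E < +oo)%E ->
  (\int[lawY w]_y (y `^ b)%:E < +oo)%E ->
  ((mix_exponent q b)%:E <= critical_exp_sq (lawV w))%E}.
Proof.
have : {ae P, forall w, forall n : nat,
    if unpickle n is Some (q, b) then 0 < ratr q :> R -> 0 < ratr b :> R ->
    (\int[lawV w]_v (expR (mix_exponent (ratr q) (ratr b) * v ^+ 2))%:E <=
    \int[lawX w]_x (1 + x `^ (- ratr q))%:E +
    \int[lawY w]_y (expR (r * tau) `^ ratr b * y `^ ratr b)%:E)%E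
    else True}.
  apply/ae_foralln => n; case: (unpickle n) => [[q b]|]; last exact: aeW.
  have [q0|q0] := ltP 0 (ratr q : R); last first.
    exact: aeW.
  have [b0|b0] := ltP 0 (ratr b : R); last first.
    exact: aeW.
  by apply: filterS (cond_expR_VIX_le q0 b0).
apply: filterS => w hw q b q0 b0 Xfin Yfin.
rewrite leNgt; apply/negP => lt.
have crit0 := critical_exp_sq_ge0 (lawV w).
move: lt crit0; case E: (critical_exp_sq (lawV w)) => [c| |]//.
rewrite lte_fin lee_fin => lt c0.
set h := mix_exponent q b in lt.
have h0 : 0 < h by exact: le_lt_trans lt.
(* Suppose the critical exponent [c] is below [h]. Then [l] lies strictly between [c / h] and 1, and
   rationals are chosen in []l * q, q[] and []l * b, b[]. Being smaller than [q] and [b], they keep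
   the moments finite. Since [mix_exponent] is increasing in both arguments and homogeneous of
   degree one, its value there is at least [l * h > c], a contradiction. *)
pose l := (c / h + 1) / 2.
have ch1 : c / h < 1 by rewrite ltr_pdivrMr// mul1r.
have ch0 : 0 <= c / h by rewrite divr_ge0// ltW.
have l1 : l < 1 by rewrite /l; lra.
have l0 : 0 < l by rewrite /l; lra.
have lh : c < l * h by rewrite -ltr_pdivrMr// /l; lra.
have [q' ] : exists q' : rat, ratr q' \in `]l * q, q[.
  by apply: rat_in_itvoo; nra.
rewrite in_itv/= => /andP[lq q'q].
have [b' ] : exists b' : rat, ratr b' \in `]l * b, b[.
  by apply: rat_in_itvoo; nra.
rewrite in_itv/= => /andP[lb b'b].
have q'0 : 0 < ratr q' :> R by apply: lt_trans lq; exact: mulr_gt0.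
have b'0 : 0 < ratr b' :> R by apply: lt_trans lb; exact: mulr_gt0.
have := hw (pickle (q', b')); rewrite pickleK => /(_ q'0 b'0) fin.
have : ((mix_exponent (ratr q') (ratr b'))%:E <= critical_exp_sq (lawV w))%E.
  apply: ereal_sup_ubound; exists (mix_exponent (ratr q') (ratr b')) => //; split.
    exact: mix_exponent_ge0.
  apply: (le_lt_trans fin); rewrite lte_add_pinfty//.
    apply: (@ge0_integralD_lty _ (fun x => x `^ (- q)) _ 2) Xfin => //.
    - by apply: measurable_funD => //; exact: measurable_powR.
    - by move=> x; rewrite powR_ge0.
    - by move=> x; rewrite addr_ge0 ?powR_ge0.
    - move=> x; have := powRN_le1D x (ltW q'0) (ltW q'q); lra.
  under eq_integral do rewrite EFinM.
  rewrite ge0_integralZl//; last 2 first.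
  - by apply/measurable_EFinP; exact: measurable_powR.
  - by move=> y _; rewrite lee_fin powR_ge0.
  rewrite lte_mul_pinfty ?lee_fin ?powR_ge0//.
  apply: (@ge0_integralD_lty _ (fun x => x `^ b) _ 1) Yfin => //.
  - by move=> x; rewrite powR_ge0.
  - by move=> x; rewrite powR_ge0.
  - by move=> x; exact: powR_le1D (ltW b'0) (ltW b'b).
rewrite E lee_fin leNgt => /negP; apply.
apply: (lt_le_trans lh); rewrite /h /mix_exponent mulrCA ler_wpM2l//.
  by rewrite divr_ge0// ltW.
move: (ratr q') (ratr b') lq q'q lb b'b q'0 b'0 => q1 b1 lq q'q lb b'b q'0 b'0.
rewrite -subr_ge0 (_ : _ - _ =
    (q1 * b1 * (q + b) - l * (q * b) * (q1 + b1)) / ((q1 + b1) * (q + b))); last first.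
  by field; rewrite !gt_eqF ?addr_gt0.
apply: divr_ge0; last by rewrite mulr_ge0 ?addr_ge0 ?ltW.
rewrite subr_ge0.
(* These two inequalities add up to the goal. *)
have h1 : q1 * q * (l * b) <= q1 * q * b1.
  by rewrite ler_wpM2l ?mulr_ge0// ltW.
have h2 : b1 * b * (l * q) <= b1 * b * q1.
  by rewrite ler_wpM2l ?mulr_ge0// ltW.
lra.
Qed.

End vix.

(** * Gaussian tails and Black-Scholes prices *)

Section normal_cdf.
Context {R : realType}.
Implicit Types x y z D : R.

(* Chernoff bound: on A the standard density is at most expR (- z ^+ 2 / 2)
   times the density of mean z. *)
Lemma normal_prob_tail z (A : set (measurableTypeR R)) : measurable A ->
  (forall x, A x -> 0 <= z * (x - z)) ->
  (normal_prob 0 1 A <= (expR (- z ^+ 2 / 2))%:E)%E.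
Proof.
move=> mA Az.
have mpdf m : measurable_fun [set: measurableTypeR R]
      (fun x => (normal_pdf m 1 x)%:E).
  by apply/measurable_EFinP; exact: measurable_normal_pdf.
apply: (@le_trans _ _ (\int[lebesgue_measure]_(x in A)
    ((expR (- z ^+ 2 / 2))%:E * (normal_pdf z 1 x)%:E))%E).
  apply: ge0_le_integral => //.
  - by move=> x _; rewrite lee_fin normal_pdf_ge0.
  - exact: measurable_funTS.
  - by apply: measurable_funTS; exact: measurable_funeM.
  - move=> x Ax; rewrite -EFinM lee_fin !normal_pdfE// /normal_fun.
    rewrite mulrCA ler_wpM2l ?normal_peak_ge0// -expRD ler_expR subr0.
    rewrite expr1n -mulr_natl mulr1 -mulrDl ler_wpM2r ?invr_ge0//.
    by have := Az _ Ax; nra.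
rewrite ge0_integralZl//.
- rewrite -[leRHS]mule1 lee_wpmul2l ?lee_fin ?expR_ge0//.
  rewrite -(integral_normal_pdf z 1); apply: ge0_subset_integral => //.
  by move=> x _; rewrite lee_fin normal_pdf_ge0.
- exact: measurable_funTS.
- by move=> x _; rewrite lee_fin normal_pdf_ge0.
Qed.

Let N_fin (A : set (measurableTypeR R)) : measurable A ->
  normal_prob 0 1 A = (fine (normal_prob 0 1 A))%:E :> \bar R.
Proof. by move=> mA; rewrite fineK// fin_num_measure. Qed.

Lemma PhiE x : (Phi x)%:E = normal_prob 0 1 `]-oo, x].
Proof. by rewrite /Phi -N_fin. Qed.

Lemma Phi_ge0 x : 0 <= Phi x.
Proof. by rewrite -lee_fin PhiE. Qed.

Lemma Phi_le1 x : Phi x <= 1.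
Proof. by rewrite -lee_fin PhiE probability_le1. Qed.

Lemma PhiC x : (1 - Phi x)%:E = normal_prob 0 1 `]x, +oo[.
Proof. by rewrite EFinB PhiE -probability_setC// setCitvl. Qed.

Lemma expR_sqr_le D z : 0 <= D -> D <= z -> expR (- z ^+ 2 / 2) <= expR (- D ^+ 2 / 2).
Proof. by move=> D0 Dz; rewrite ler_expR; nra. Qed.

Lemma Phi_le_expR D z : 0 <= D -> z <= - D -> Phi z <= expR (- D ^+ 2 / 2).
Proof.
move=> D0 zD; apply: (@le_trans _ _ (expR (- (- z) ^+ 2 / 2))); last first.
  by apply: expR_sqr_le => //; rewrite lerNr.
rewrite -lee_fin PhiE sqrrN; apply: normal_prob_tail => // x /=.
by rewrite in_itv/= => xz; nra.
Qed.

Lemma PhiC_le_expR D z : 0 <= D -> D <= z -> 1 - Phi z <= expR (- D ^+ 2 / 2).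
Proof.
move=> D0 Dz; apply: (@le_trans _ _ (expR (- z ^+ 2 / 2))); last exact: expR_sqr_le.
rewrite -lee_fin PhiC; apply: normal_prob_tail => // x /=.
by rewrite in_itv/= andbT => xz; nra.
Qed.

(** The standard normal density is bounded by its peak. *)
Lemma Phi_lipschitz x y : x <= y ->
  0 <= Phi y - Phi x <= normal_peak 1 * (y - x).
Proof.
move=> xy.
have yx : (Phi y - Phi x)%:E = normal_prob 0 1 `]x, y].
  rewrite EFinB !PhiE (_ : `]-oo, y]%classic = `]-oo, x] `|` `]x, y]); last first.
    by rewrite -itv_bndbnd_setU.
  rewrite measureU//; last first.
    apply/seteqP; split=> z //= []; rewrite !in_itv/= => zx /andP[xz _].
    by have := le_lt_trans zx xz; rewrite ltxx.
  by rewrite addeAC subee ?add0e// fin_num_measure.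
rewrite -!lee_fin yx measure_ge0/=.
apply: (@le_trans _ _ (\int[lebesgue_measure]_(z in `]x, y]) (normal_peak 1)%:E)%E).
  apply: ge0_le_integral => //.
  - by move=> z _; rewrite lee_fin normal_pdf_ge0.
  - by apply/measurable_EFinP/measurable_funTS; exact: measurable_normal_pdf.
  - by move=> z _; rewrite lee_fin normal_pdf_ub.
rewrite integral_cst//= lebesgue_measure_itv/= lte_fin.
case: ifPn => //; rewrite mule0 lee_fin mulr_ge0 ?normal_peak_ge0//.
by rewrite subr_ge0.
Qed.

Lemma continuous_Phi : continuous (@Phi R).
Proof.
move=> x; apply/cvgrPdist_le => e e0.
have c0 : 0 < normal_peak (1 : R) by exact: normal_peak_gt0.
near=> y.
have yx : `|x - y| <= e / normal_peak 1.
  by near: y; apply: cvgr_dist_le; [exact: cvg_id|exact: divr_gt0].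
have h : normal_peak 1 * `|x - y| <= e by rewrite mulrC -ler_pdivlMr.
apply: le_trans h.
have [xy|/ltW xy] := leP x y.
  rewrite distrC (distrC x) !ger0_norm ?subr_ge0//.
    by case/andP: (Phi_lipschitz xy).
  by rewrite -subr_ge0; case/andP: (Phi_lipschitz xy).
rewrite !ger0_norm ?subr_ge0//.
  by case/andP: (Phi_lipschitz xy).
by rewrite -subr_ge0; case/andP: (Phi_lipschitz xy).
Unshelve. all: by end_near. Qed.

End normal_cdf.

(** * The Black-Scholes put as a function of total volatility *)

Section black_scholes.
Context {R : realType}.
Implicit Types m K k p s x b D c : R.

(* Undiscounted price as a function of log-moneyness k = ln (m / K) and total
   volatility s. *)
Definition bs_put m K k s : R :=
  Phi (- (k / s - s / 2)) * K - Phi (- (k / s + s / 2)) * m.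

Lemma exists_small_gaussian c : 0 < c ->
  exists2 D, 0 <= D & expR (- D ^+ 2 / 2) < c.
Proof.
(* With [u = |ln c|], half the square of this [D] is [1 / 2 + 2 u + 2 u^2], which exceeds
   [- ln c]. *)
move=> c0; exists (1 + 2 * `|ln c|); first by rewrite addr_ge0// mulr_ge0.
rewrite -[ltRHS](lnK c0) ltr_expR.
have := ler_norm (- ln c); rewrite normrN; have := normr_ge0 (ln c).
by move: `|ln c| (ln c) => u v; nra.
Qed.

(** In this bound and the next two, [D] measures how far into the Gaussian tail the arguments of
    [Phi] lie. They place the price near 0, near [K - m] and near [K] respectively. *)
Lemma bs_put_le_put m K k s D : 0 <= m -> 0 <= K -> 0 <= D -> D <= k / s - s / 2 ->
  bs_put m K k s <= K * expR (- D ^+ 2 / 2).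
Proof.
move=> m0 K0 D0 Dk; rewrite /bs_put.
have : Phi (- (k / s - s / 2)) <= expR (- D ^+ 2 / 2).
  by apply: Phi_le_expR => //; rewrite lerN2.
have := Phi_ge0 (- (k / s + s / 2)); nra.
Qed.

Lemma bs_put_le_call m K k s D : 0 <= m -> 0 <= K -> 0 <= D -> D <= - (k / s + s / 2) ->
  bs_put m K k s <= K - m + m * expR (- D ^+ 2 / 2).
Proof.
move=> m0 K0 D0 Dk; rewrite /bs_put.
have := PhiC_le_expR D0 Dk.
have := Phi_le1 (- (k / s - s / 2)); nra.
Qed.

Lemma bs_put_ge m K k s D : 0 <= m -> 0 <= K -> 0 <= D ->
  D <= - (k / s - s / 2) -> D <= k / s + s / 2 ->
  K - (K + m) * expR (- D ^+ 2 / 2) <= bs_put m K k s.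
Proof.
move=> m0 K0 D0 Dk Dk'; rewrite /bs_put.
have := PhiC_le_expR D0 Dk.
have : Phi (- (k / s + s / 2)) <= expR (- D ^+ 2 / 2).
  by apply: Phi_le_expR => //; rewrite lerN2.
nra.
Qed.

Lemma bs_put_continuous m K k s : 0 < s -> {for s, continuous (bs_put m K k)}.
Proof.
move=> s0; have s_neq0 : s != 0 by rewrite gt_eqF.
have cks : k / x @[x --> s] --> k / s by apply: cvgMr; exact: cvgV.
have cs2 : x / 2 @[x --> s] --> s / 2 by apply: cvgMl; exact: cvg_id.
apply: cvgB; apply: cvgMl.
  apply: (continuous_cvg _ (@continuous_Phi R _)); apply: cvgN; exact: cvgB.
apply: (continuous_cvg _ (@continuous_Phi R _)); apply: cvgN; exact: cvgD.
Qed.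

(** Intermediate value theorem. At a small [s0] the price is close to 0 if [k > 0] and to [K - m] if
    [k < 0], hence below [p]; at a large [s1] it is close to [K]. As [k] is nonzero, [k / s] blows
    up when [s] tends to 0. *)
Lemma bs_put_onto m K k p : 0 < m -> 0 < K -> k != 0 -> 0 < p ->
  K - m < p -> p < K -> exists2 s, 0 < s & bs_put m K k s = p.
Proof.
move=> m0 K0 k0 p0 Kmp pK.
have [D D0 Dp] : exists2 D, 0 <= D &
    expR (- D ^+ 2 / 2) < Num.min (p / K) ((p - (K - m)) / m).
  apply: exists_small_gaussian; rewrite lt_min !divr_gt0//; lra.
have [D' D'0 D'p] : exists2 D, 0 <= D & expR (- D ^+ 2 / 2) < (K - p) / (K + m).
  by apply: exists_small_gaussian; apply: divr_gt0; lra.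
move: Dp; rewrite lt_min !ltr_pdivlMr// => /andP[DpK Dpm].
move: D'p; rewrite ltr_pdivlMr ?addr_gt0// => D'p.
have ak : 0 < `|k| by rewrite normr_gt0.
(* These choices give [|k| / s0 - s0 / 2 >= D], because [s0 <= 1], and [s1 / 2 - |k| / s1 >= D'],
   because [|k| / s1 <= 1]. *)
pose s0 := `|k| / (2 * D + `|k| + 1).
pose s1 := 2 * D' + `|k| + 2.
have den : 0 < 2 * D + `|k| + 1 by lra.
have s00 : 0 < s0 by rewrite divr_gt0.
have s01 : s0 <= 1 by rewrite ler_pdivrMr//; lra.
have s11 : 2 <= s1 by rewrite /s1; lra.
have s10 : 0 < s1 by lra.
have ks0 : `|k| / s0 = 2 * D + `|k| + 1 by rewrite /s0 invf_div mulrCA divff ?mulr1// gt_eqF.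
have ks1 : 0 <= `|k| / s1 <= 1.
  apply/andP; split; first by rewrite divr_ge0// ltW.
  by rewrite ler_pdivrMr// /s1; lra.
have b0 : bs_put m K k s0 < p.
  have [kp|kn] := leP 0 k.
    apply: le_lt_trans (_ : _ <= K * expR (- D ^+ 2 / 2)) _; last by lra.
    apply: bs_put_le_put => //; [exact: ltW|exact: ltW|].
    by move: ks0; rewrite ger0_norm// => ->; lra.
  apply: le_lt_trans (_ : _ <= K - m + m * expR (- D ^+ 2 / 2)) _; last by lra.
  apply: bs_put_le_call => //; [exact: ltW|exact: ltW|].
  by move: ks0; rewrite ltr0_norm// mulNr => /eqP; rewrite eqr_oppLR => /eqP ->; lra.
have b1 : p < bs_put m K k s1.
  apply: lt_le_trans (_ : _ < K - (K + m) * expR (- D' ^+ 2 / 2)) _; first by lra.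
  have ks1' : - 1 <= k / s1 <= 1.
    by rewrite -ler_norml normrM (gtr0_norm (_ : 0 < s1^-1)) ?invr_gt0//; case/andP: ks1.
  by apply: bs_put_ge => //; rewrite ?ltW//; rewrite {2}/s1; lra.
have s01' : s0 <= s1 by lra.
have [||c] := @IVT R (bs_put m K k) s0 s1 p s01'.
- apply: continuous_in_subspaceT => x; rewrite inE/= in_itv/= => /andP[s0x _].
  by apply: bs_put_continuous; exact: lt_le_trans s0x.
- by rewrite ge_min le_max (ltW b0) (ltW b1) orbT.
- by rewrite in_itv/= => /andP[s0c _] cp; exists c => //; exact: lt_le_trans s0c.
Qed.

(** Since [x / s - s / 2] decreases in [s], the worst case is [s ^+ 2 = b * x], where half its
    square equals [x * ((2 - b) ^+ 2 / (8 * b))]. *)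
Lemma gaussian_log_moneyness x b s : 0 < x -> 0 < b -> b < 2 -> 0 < s ->
  s ^+ 2 <= b * x ->
  0 <= x / s - s / 2 /\
  expR (- (x / s - s / 2) ^+ 2 / 2) <= expR (- (x * ((2 - b) ^+ 2 / (8 * b)))).
Proof.
move=> x0 b0 b2 s0 sbx.
have -> : x / s - s / 2 = (x - s ^+ 2 / 2) / s by field; rewrite gt_eqF.
have h : x * (1 - b / 2) <= x - s ^+ 2 / 2 by nra.
have h0 : 0 < x * (1 - b / 2) by rewrite mulr_gt0//; lra.
split; first by rewrite divr_ge0 ?ltW//; lra.
rewrite ler_expR mulNr lerN2 expr_div_n.
have -> : x * ((2 - b) ^+ 2 / (8 * b)) = (x * (1 - b / 2)) ^+ 2 / (b * x) / 2.
  by field; rewrite !gt_eqF.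
rewrite ler_wpM2r// ler_pM//.
- exact: sqr_ge0.
- by rewrite invr_ge0 ltW// mulr_gt0.
- by rewrite lerXn2r ?nnegrE//; lra.
- by rewrite lef_pV2 ?posrE ?exprn_gt0 ?mulr_gt0.
Qed.

End black_scholes.

(** * Finite moments from power-law tails *)

Section tail_moment.
Context {R : realType} {d : measure_display} {T : measurableType d}.
Variables (mu : probability T R) (Z : T -> R).
Hypothesis mZ : measurable_fun setT Z.

Let mtail z : measurable [set x | z <= Z x].
Proof.
rewrite -[X in measurable X]setTI; exact: measurable_fun_le.
Qed.

(** When [2 ^+ n <= z < 2 ^+ n.+1], the term of index [n] alone dominates. For [z <= 1] the constant
    1 suffices, also at negative [z], where the power is 1. *)
Lemma powR_dyadic_le (z q : R) : 0 <= q ->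
  ((z `^ q)%:E <= 1 + \sum_(n <oo) ((2 `^ (n.+1%:R * q)) * (2 ^+ n <= z)%R%:R)%:E)%E.
Proof.
move=> q0.
have S0 : (0 <= \sum_(n <oo) ((2 `^ (n.+1%:R * q)) * (2 ^+ n <= z)%R%:R)%:E)%E.
  by apply: nneseries_ge0 => n _ _; rewrite lee_fin mulr_ge0 ?powR_ge0.
have [z1|z1] := leP z 1.
  apply: (@le_trans _ _ 1%E); last by rewrite leeDl.
  rewrite lee_fin; have [z0|z0] := leP z 0.
    move: z0; rewrite le_eqVlt => /predU1P[->|z0].
      by have [->|q_neq0] := eqVneq q 0; rewrite ?powRr0// powR0.
    by rewrite /powR (lt_eqF z0) ln0 ?mulr0 ?expR0// ltW.
  apply: (@le_trans _ _ (1 `^ q)); last by rewrite powR1.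
  by apply: ge0_ler_powR => //; rewrite nnegrE// ltW.
have ex : exists n, z < 2 ^+ n.
  exists (Num.truncn z).+1; apply: lt_le_trans (truncnS_gt z) _.
  by rewrite -natrX ler_nat ltnW// ltn_expl.
case: (ex_minnP ex) => -[|n] zn nmin; first by move: zn; rewrite expr0 ltNge (ltW z1).
have nz : 2 ^+ n <= z by rewrite leNgt; apply/negP => /nmin; rewrite ltnn.
apply: (@le_trans _ _ (2 `^ (n.+1%:R * q))%:E).
  rewrite lee_fin powRrM powR_mulrn//.
  apply: ge0_ler_powR; rewrite ?nnegrE ?exprn_ge0// ltW//.
  exact: lt_trans z1.
apply: (@le_trans _ _ (\sum_(n <oo) ((2 `^ (n.+1%:R * q)) * (2 ^+ n <= z)%R%:R)%:E)%E);
  last by rewrite leeDr// lee_fin.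
apply: le_trans (nneseries_lim_ge n.+1 _); last first.
  by move=> i _ _; rewrite lee_fin mulr_ge0 ?powR_ge0.
by rewrite big_nat_recr//= nz mulr1 leeDr// sume_ge0.
Qed.

Lemma tail_moment_lty (C z0 g q : R) : 0 < z0 -> 0 <= C -> 0 <= q -> q < g ->
  (forall z, z0 <= z -> (mu [set x | (z <= Z x)%R] <= (C * z `^ (- g))%:E)%E) ->
  (\int[mu]_x (Z x `^ q)%:E < +oo)%E.
Proof.
move=> z00 C0 q0 qg tail.
have g0 : 0 < g by exact: le_lt_trans qg.
pose C' := C + z0 `^ g.
have C'0 : 0 <= C' by rewrite addr_ge0 ?powR_ge0.
have tail' n : (mu [set x | (2 ^+ n <= Z x)%R] <= (C' * (2 ^+ n) `^ (- g))%:E)%E.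
  have [zn|nz] := leP z0 (2 ^+ n).
    apply: le_trans (tail _ zn) _.
    by rewrite lee_fin ler_wpM2r ?powR_ge0// lerDl powR_ge0.
  apply: (le_trans (probability_le1 mu (mtail _))); rewrite lee_fin.
  apply: (@le_trans _ _ (z0 `^ g * (2 ^+ n) `^ (- g))); last first.
    by rewrite ler_wpM2r ?powR_ge0// lerDr.
  rewrite powRN ler_pdivlMr ?powR_gt0// mul1r.
  by apply: ge0_ler_powR; rewrite ?nnegrE ?exprn_ge0 ?ltW.
have indE n y : (2 ^+ n <= Z y)%R%:R = \1_[set x | (2 ^+ n <= Z x)%R] y :> R.
  rewrite indicE; have [h|h] := boolP (2 ^+ n <= Z y); first by rewrite mem_set.
  by rewrite memNset//; exact/negP.
have mterm n : measurable_fun setT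
    (fun x => ((2 `^ (n.+1%:R * q)) * (2 ^+ n <= Z x)%R%:R)%:E : \bar R).
  under eq_fun do rewrite indE.
  by apply/measurable_EFinP/measurable_funM => //; exact: measurable_indic.
pose x := 2 `^ (q - g) : R.
have x1 : `|x| < 1.
  rewrite ger0_norm ?powR_ge0// /x /powR pnatr_eq0/= -[ltRHS]expR0 ltr_expR.
  by rewrite nmulr_rlt0 ?subr_lt0// ln_gt0// ltr1n.
apply: (@le_lt_trans _ _ (1 + \sum_(n <oo)
    ((2 `^ (n.+1%:R * q))%:E * mu [set x | (2 ^+ n <= Z x)%R]))%E).
  apply: (@le_trans _ _ (\int[mu]_y (1 + \sum_(n <oo)
      ((2 `^ (n.+1%:R * q)) * (2 ^+ n <= Z y)%R%:R)%:E))%E).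
    apply: ge0_le_integral => //.
    - by move=> y _; rewrite lee_fin powR_ge0.
    - apply/measurable_EFinP; exact: (measurableT_comp (measurable_powR q) mZ).
    - apply: emeasurable_funD => //; by apply: ge0_emeasurable_sum.
    - by move=> y _; exact: powR_dyadic_le.
  rewrite ge0_integralD//; last 2 first.
  - by move=> y _; apply: nneseries_ge0 => n _ _; rewrite lee_fin mulr_ge0 ?powR_ge0.
  - by apply: ge0_emeasurable_sum.
  rewrite integral_cst// mul1e; apply: leeD; first exact: probability_le1.
  rewrite integral_nneseries//.
  apply: lee_nneseries => [n _ _|n _].
    by apply: integral_ge0 => y _; rewrite lee_fin mulr_ge0 ?powR_ge0.
  under eq_integral do rewrite indE EFinM.
  rewrite ge0_integralZl ?lee_fin ?powR_ge0//.
  - by rewrite integral_indic// setIT.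
  - by apply/measurable_EFinP; exact: measurable_indic.
apply: (@le_lt_trans _ _ (1 + (2 `^ q * C' * (1 - x)^-1)%:E)%E); last by rewrite ltry.
rewrite leeD2l//; apply: lime_le.
  by apply: is_cvg_nneseries => n _ _; rewrite mule_ge0// lee_fin powR_ge0.
apply: nearW => n.
apply: (@le_trans _ _ (\sum_(0 <= i < n) (2 `^ q * C' * x ^+ i)%:E)%E).
  apply: lee_sum => i _.
  apply: (@le_trans _ _ ((2 `^ (i.+1%:R * q))%:E * (C' * (2 ^+ i) `^ (- g))%:E)%E).
    by rewrite lee_wpmul2l// lee_fin powR_ge0.
  rewrite -EFinM lee_fin le_eqVlt; apply/orP; left; apply/eqP.
  have two r s : 2 `^ (r + s) = 2 `^ r * 2 `^ s :> R.
    by rewrite powRD// pnatr_eq0 implybT.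
  rewrite -!powR_mulrn ?powR_ge0// -!powRrM mulrCA (mulrC (2 `^ q)) -mulrA -!two.
  by congr (_ * 2 `^ _); rewrite -natr1; ring.
rewrite sumEFin lee_fin.
apply: geometric_le_lim => //; first by rewrite mulr_ge0 ?powR_ge0.
by rewrite powR_gt0.
Qed.

End tail_moment.

(** * Lee's moment formula *)

(** Expanded, this is [1 / (2 b) + b / 8 - 1 / 2], the critical moment that Lee's formula attaches
    to a wing of slope [b]. *)
Definition lee_exponent {R : realType} (b : R) : R := (2 - b) ^+ 2 / (8 * b).

Definition undiscounted_put {R : realType} (mu : probability (measurableTypeR R) R)
  (K : R) : R := \int[mu]_s Num.max (K - s) 0.

Section lee.
Context {R : realType}.
Variable mu : probability (measurableTypeR R) R.
Hypothesis mu_gt0 : mu `]-oo, 0]%classic = 0%E.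
Hypothesis imu : mu.-integrable setT EFin.
Local Notation m := (mean mu).
Local Notation put := (undiscounted_put mu).

(** A vanishing integral would make [f] zero almost everywhere on []0, +oo[], a set of full measure
    on which [f] is positive. *)
Lemma Rintegral_gt0 (f : R -> R) : mu.-integrable setT (EFin \o f) ->
  (forall s, 0 < s -> 0 < f s) -> 0 < \int[mu]_s f s.
Proof.
move=> fi f0.
have ifin := integrable_fin_num measurableT fi.
have mf : measurable_fun setT (EFin \o f) by exact: measurable_int fi.
have E : (\int[mu]_s (f s)%:E = \int[mu]_(s in `]0%R, +oo[) (f s)%:E)%E.
  rewrite (@negligible_integral _ _ R mu setT
    (`]-oo, 0]%classic : set (measurableTypeR R)))//.
  by rewrite setTD setCitvl.
rewrite /Rintegral fine_gt0//; apply/andP; split; last first.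
  by move: ifin; rewrite fin_numElt => /andP[].
rewrite E lt0e; apply/andP; split; last first.
  apply: integral_ge0 => s /=; rewrite in_itv/= andbT => s0.
  by rewrite lee_fin ltW// f0.
apply/negP => /eqP I0.
have : ae_eq mu `]0, +oo[%classic (EFin \o f) (cst 0%E).
  apply/ae_eq_integral_abs => //; first exact: measurable_funTS.
  rewrite -[RHS]I0; apply: eq_integral => s; rewrite inE/= in_itv/= andbT => s0.
  by rewrite /= ger0_norm// ltW// f0.
move=> [N [mN muN0 subN]].
have sub : `]0, +oo[%classic `<=` N.
  move=> s s0; apply: subN => /= /(_ s0) [] fs0; move: s0.
  by rewrite /= in_itv/= andbT => /f0; rewrite fs0 ltxx.
have := @probability_setC _ _ _ mu `]-oo, 0]%classic (measurable_itv _).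
rewrite setCitvl mu_gt0 sube0 => mu1.
have : (1%:E <= 0%:E :> \bar R)%E.
  rewrite -mu1 -[leRHS]muN0.
  exact: (le_measure mu (mem_set (measurable_itv `]0, +oo[)) (mem_set mN) sub).
by rewrite lee_fin ler10.
Qed.

Lemma mean_gt0 : 0 < m.
Proof. exact: (Rintegral_gt0 imu). Qed.

Let integrable_dominated (f : R -> R) (c : R) : measurable_fun setT f ->
  (forall s, `|f s| <= c + `|s|) -> mu.-integrable setT (EFin \o f).
Proof.
move=> mf fc.
have h : mu.-integrable setT ((EFin \o cst c) \+ (fun s => `|s%:E|)%E).
  apply: integrableD => //; first exact: finite_measure_integrable_cst.
  exact: integrable_abse.
apply: (le_integrable measurableT _ _ h); first exact/measurable_EFinP.
by move=> s _; rewrite /= lee_fin (le_trans (fc s))//; exact: ler_norm.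
Qed.

Lemma measurable_put K : measurable_fun setT (fun s : R => Num.max (K - s) 0).
Proof. by apply: measurable_maxr => //; exact: measurable_funB. Qed.

Lemma measurable_call K : measurable_fun setT (fun s : R => Num.max (s - K) 0).
Proof. by apply: measurable_maxr => //; exact: measurable_funB. Qed.

Lemma integrable_put K : mu.-integrable setT (EFin \o (fun s => Num.max (K - s) 0)).
Proof.
apply: (@integrable_dominated _ `|K|); first exact: measurable_put.
move=> s; rewrite ger0_norm ?le_max ?lexx ?orbT// ge_max addr_ge0// andbT.
by rewrite (le_trans (ler_norm _))// ler_normB.
Qed.

Lemma integrable_call K : mu.-integrable setT (EFin \o (fun s => Num.max (s - K) 0)).
Proof.
apply: (@integrable_dominated _ `|K|); first exact: measurable_call.
move=> s; rewrite ger0_norm ?le_max ?lexx ?orbT// ge_max addr_ge0// andbT.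
by rewrite (le_trans (ler_norm _))// distrC ler_normB.
Qed.

Let Rint_cst (K : R) : \int[mu]_s K = K.
Proof. by rewrite Rintegral_cst//= probability_setT/= mulr1. Qed.

Let cst_int (K : R) : mu.-integrable setT (EFin \o (fun=> K)).
Proof. exact: finite_measure_integrable_cst. Qed.

(** The gap is the integral of [min(s, K)], positive for [s > 0]. *)
Lemma put_lt K : 0 < K -> put K < K.
Proof.
move=> K0; rewrite -subr_gt0 -[X in X - _]Rint_cst -RintegralB//; last exact: integrable_put.
apply: Rintegral_gt0.
  exact: (integrableB measurableT (cst_int K) (integrable_put K)).
by move=> s s0; rewrite /Num.max; case: ifP => _; lra.
Qed.

Lemma put_call_parity K : \int[mu]_s Num.max (s - K) 0 = put K - (K - m).
Proof.
rewrite /undiscounted_put /mean -[X in X - \int[_]_ _ _]Rint_cst -!RintegralB//.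
- apply: eq_Rintegral => s _; rewrite /Num.max; case: ifP; case: ifP; lra.
- exact: integrable_put.
- exact: (integrableB measurableT (cst_int K) imu).
Qed.

(** Markov's inequality: the payoff is at least [K / 2] when [s <= K / 2]. *)
Lemma put_tail K : 0 < K ->
  ((K / 2)%:E * mu `]-oo, (K / 2)%R]%classic <= (put K)%:E)%E.
Proof.
move=> K0; rewrite /undiscounted_put /Rintegral fineK; last first.
  by apply: integrable_fin_num => //; exact: integrable_put.
rewrite -integral_cst//.
apply: (@le_trans _ _ (\int[mu]_(s in `]-oo, (K / 2)%R]%classic) (Num.max (K - s) 0)%:E)%E).
  apply: ge0_le_integral => //.
  - by move=> s _; rewrite lee_fin divr_ge0// ltW.
  - by apply/measurable_EFinP/measurable_funTS; exact: measurable_put.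
  - move=> s /=; rewrite in_itv/= => sK; rewrite lee_fin le_max; apply/orP; left; lra.
apply: ge0_subset_integral => //.
- by apply/measurable_EFinP; exact: measurable_put.
- by move=> s _; rewrite lee_fin le_max lexx orbT.
Qed.

(** Markov's inequality for the call, rewritten by parity: the payoff is at least [K] when
    [s >= 2 * K]. *)
Lemma call_tail K : 0 < K ->
  (K%:E * mu `[(2 * K)%R, +oo[%classic <= (put K - (K - m))%:E)%E.
Proof.
move=> K0; rewrite -put_call_parity /Rintegral fineK; last first.
  by apply: integrable_fin_num => //; exact: integrable_call.
rewrite -integral_cst//.
apply: (@le_trans _ _ (\int[mu]_(s in `[(2 * K)%R, +oo[%classic) (Num.max (s - K) 0)%:E)%E).
  apply: ge0_le_integral => //.
  - by move=> s _; rewrite lee_fin ltW.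
  - by apply/measurable_EFinP/measurable_funTS; exact: measurable_call.
  - move=> s /=; rewrite in_itv/= andbT => sK; rewrite lee_fin le_max; apply/orP; left; lra.
apply: ge0_subset_integral => //.
- by apply/measurable_EFinP; exact: measurable_call.
- by move=> s _; rewrite lee_fin le_max lexx orbT.
Qed.

Variables (r t T : R).
Hypothesis tT : t < T.
Let tau_gt0 : 0 < Num.sqrt (T - t). Proof. by rewrite sqrtr_gt0 subr_gt0. Qed.

(** A put price strictly between intrinsic value and strike is attained by [bs_put_onto], so [xget]
    returns a true solution and not its default 0. *)
Lemma implied_vol_bs_put K : 0 < K -> K != m -> 0 < put K -> K - m < put K ->
  let s := implied_vol mu r t T K * Num.sqrt (T - t) in
  0 < s /\ bs_put m K (ln (m / K)) s = put K.
Proof.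
move=> K0 Km p0 pKm.
have k0 : ln (m / K) != 0.
  rewrite ln_eq0 ?divr_gt0 ?mean_gt0//; apply: contra Km => /eqP mK1.
  by rewrite eq_sym -subr_eq0 -(divfK (lt0r_neq0 K0) m) mK1 mul1r subrr.
have [s s0 bs] := bs_put_onto mean_gt0 K0 k0 p0 pKm (put_lt K0).
have e0 : expR (- r * (T - t)) != 0 by rewrite gt_eqF// expR_gt0.
rewrite /implied_vol; case: xgetP => [v _ [v0 /(mulfI e0) vp]|].
  by split; [exact: mulr_gt0|rewrite /undiscounted_put vp].
move=> /(_ (s / Num.sqrt (T - t))) []; split; first exact: divr_gt0.
rewrite /put_price -/(put K) -bs /black_scholes_put /bs_put.
by rewrite (divfK (lt0r_neq0 tau_gt0)).
Qed.

Let total_variance_le K b : 0 < b -> K != m -> 0 < K ->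
  implied_vol mu r t T K ^+ 2 / (`|ln (K / m)| / (T - t)) <= b ->
  (implied_vol mu r t T K * Num.sqrt (T - t)) ^+ 2 <= b * `|ln (K / m)|.
Proof.
move=> b0 Km K0.
have l0 : 0 < `|ln (K / m)|.
  rewrite normr_gt0 ln_eq0 ?divr_gt0 ?mean_gt0//; apply: contra Km => /eqP mK1.
  by rewrite -subr_eq0 -(divfK (lt0r_neq0 mean_gt0) K) mK1 mul1r subrr.
have Tt : 0 < T - t by rewrite subr_gt0.
rewrite ler_pdivrMr ?divr_gt0// => h.
rewrite exprMn sqr_sqrtr; last exact: ltW.
by rewrite -ler_pdivlMr// -mulrA.
Qed.

Lemma put_le_of_implied_vol K b : 0 < b < 2 -> 0 < K < m ->
  implied_vol mu r t T K ^+ 2 / (`|ln (K / m)| / (T - t)) <= b ->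
  put K <= K * expR (- (ln (m / K) * lee_exponent b)).
Proof.
move=> /andP[b0 b2] /andP[K0 Km] ivb.
(* A worthless put may leave [implied_vol] at its default value, but then the bound is trivial. *)
have [p0|p0] := leP (put K) 0.
  by apply: le_trans p0 _; rewrite mulr_ge0 ?expR_ge0// ltW.
have Km' : K != m by rewrite lt_eqF.
have [] := implied_vol_bs_put K0 Km' p0; first lra.
have := total_variance_le b0 Km' K0 ivb.
set s := _ * Num.sqrt _ => sb s0 <-.
have k0 : 0 < ln (m / K) by rewrite ln_gt0// ltr_pdivlMr// mul1r.
have kE : `|ln (K / m)| = ln (m / K).
  by rewrite -[K / m]invf_div lnV ?posrE ?divr_gt0 ?mean_gt0// normrN gtr0_norm.
rewrite kE in sb.
have [d0 dle] := gaussian_log_moneyness k0 b0 b2 s0 sb.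
apply: (le_trans (bs_put_le_put (ltW mean_gt0) (ltW K0) d0 (lexx _))).
by rewrite ler_wpM2l// ltW.
Qed.

Lemma call_le_of_implied_vol K b : 0 < b < 2 -> m < K ->
  implied_vol mu r t T K ^+ 2 / (ln (K / m) / (T - t)) <= b ->
  put K - (K - m) <= m * expR (- (ln (K / m) * lee_exponent b)).
Proof.
move=> /andP[b0 b2] Km ivb.
have m0 := mean_gt0.
have K0 : 0 < K by exact: lt_trans Km.
(* Likewise for a worthless call. *)
have [p0|p0] := leP (put K - (K - m)) 0.
  by apply: le_trans p0 _; rewrite mulr_ge0 ?expR_ge0// ltW.
have Km' : K != m by rewrite gt_eqF.
have k0 : 0 < ln (K / m) by rewrite ln_gt0// ltr_pdivlMr// mul1r.
have [] := implied_vol_bs_put K0 Km'; [lra|lra|].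
have := total_variance_le b0 Km' K0; rewrite gtr0_norm// => /(_ ivb).
set s := _ * Num.sqrt _ => sb s0 <-.
have kE : ln (m / K) = - ln (K / m).
  by rewrite -[m / K]invf_div lnV ?posrE ?divr_gt0.
have [d0 dle] := gaussian_log_moneyness k0 b0 b2 s0 sb.
have dE : ln (K / m) / s - s / 2 <= - (ln (m / K) / s + s / 2).
  by rewrite kE mulNr opprD opprK.
have := bs_put_le_call (ltW m0) (ltW K0) d0 dE.
have := ler_wpM2l (ltW m0) dle; rewrite -/(lee_exponent b); lra.
Qed.

(** The tail of [1 / s] beyond [z] is the mass of [s <= 1 / z], estimated by the put of strike
    [2 / z]. The threshold [4 / Num.min D m] keeps this strike below both [D] and [m]. *)
Lemma neg_moment_of_implied_vol b q D : 0 < b < 2 -> 0 < D -> 0 <= q -> q < lee_exponent b ->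
  (forall K, 0 < K < D ->
    implied_vol mu r t T K ^+ 2 / (`|ln (K / m)| / (T - t)) <= b) ->
  (\int[mu]_s (s `^ (- q))%:E < +oo)%E.
Proof.
move=> b02 D0 q0 qg ivb.
have m0 := mean_gt0.
under eq_integral do rewrite -mulN1r powRrM.
have e0 : 0 < Num.min D m by rewrite lt_min D0.
apply: (@tail_moment_lty _ _ _ mu (fun s => s `^ (- 1)) _ (2 * (m / 2) `^ (- lee_exponent b))
  (4 / Num.min D m) (lee_exponent b) q) => //.
- by rewrite divr_gt0.
- by rewrite mulr_ge0 ?powR_ge0.
move=> z z4.
have z0 : 0 < z by apply: lt_le_trans z4; rewrite divr_gt0.
have K0 : 0 < 2 / z by rewrite divr_gt0.
have /andP[KD Km] : (2 / z < D) && (2 / z < m).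
  rewrite -lt_min ltr_pdivrMr// mulrC -ltr_pdivrMr//; apply: lt_le_trans z4.
  by rewrite ltr_pM2r ?invr_gt0// ltr_nat.
have Kb : 0 < 2 / z < m by rewrite K0.
have KD' : 0 < 2 / z < D by rewrite K0.
have := put_le_of_implied_vol b02 Kb (ivb _ KD').
rewrite -lee_fin => /(le_trans (put_tail K0)).
rewrite (_ : 2 / z / 2 = z^-1); last by field; rewrite gt_eqF.
have -> : expR (- (ln (m / (2 / z)) * lee_exponent b)) = (m / 2 * z) `^ (- lee_exponent b).
  rewrite /powR gt_eqF ?mulr_gt0 ?divr_gt0// mulNr mulrC.
  by congr (expR (- (_ * ln _))); field; rewrite gt_eqF.
rewrite powRM; [|by rewrite divr_ge0// ltW|exact: ltW] => h.
apply: (@le_trans _ _ (mu `]-oo, z^-1%R]%classic)).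
  apply: le_measure; rewrite ?inE//.
    by rewrite -[X in measurable X]setTI; apply: measurable_fun_le.
  move=> s /= zs; rewrite in_itv/=; have [s0|s0] := leP s 0.
    by rewrite (le_trans s0)// invr_ge0 ltW.
  move: zs; rewrite powR_inv1; last exact: ltW.
  by move=> zs; rewrite -[s]invrK lef_pV2 ?posrE ?invr_gt0.
move: h; rewrite -(@lee_pmul2l _ z%:E)// ?lte_fin// muleA -EFinM mulfV ?gt_eqF// mul1e.
move=> /le_trans; apply; rewrite -EFinM lee_fin le_eqVlt; apply/orP; left; apply/eqP.
by field; rewrite gt_eqF.
Qed.

(** The tail beyond [z] is estimated by the call of strike [z / 2]. Dividing by the strike improves
    the decay by one power of [z], hence the exponents [1 + p] and [1 + lee_exponent b]. *)
Lemma pos_moment_of_implied_vol b p M : 0 < b < 2 -> 0 <= p -> p < lee_exponent b ->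
  (forall K, M < K ->
    implied_vol mu r t T K ^+ 2 / (ln (K / m) / (T - t)) <= b) ->
  (\int[mu]_s (s `^ (1 + p))%:E < +oo)%E.
Proof.
move=> b02 p0 pg ivb.
have m0 := mean_gt0.
apply: (@tail_moment_lty _ _ _ mu id _ (2 * m * (2 * m)^-1 `^ (- lee_exponent b))
  (2 * (Num.max M m + 1)) (1 + lee_exponent b) (1 + p)) => //.
- by rewrite mulr_gt0// ltr_pwDr// le_max (ltW m0) orbT.
- by rewrite mulr_ge0 ?powR_ge0// mulr_ge0// ltW.
- by rewrite addr_ge0.
- by rewrite ltrD2l.
move=> z zM.
have /andP[MK mK] : (M < z / 2) && (m < z / 2).
  by rewrite -gt_max ltr_pdivlMr//; lra.
have K0 : 0 < z / 2 by exact: lt_trans mK.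
have z0 : 0 < z by lra.
have := call_le_of_implied_vol b02 mK (ivb _ MK).
rewrite -lee_fin => /(le_trans (call_tail K0)).
rewrite (_ : 2 * (z / 2) = z); last by field.
have -> : expR (- (ln (z / 2 / m) * lee_exponent b)) = ((2 * m)^-1 * z) `^ (- lee_exponent b).
  rewrite /powR gt_eqF ?mulr_gt0 ?invr_gt0 ?mulr_gt0// mulNr mulrC.
  by congr (expR (- (_ * ln _))); field; rewrite gt_eqF.
rewrite powRM; [|by rewrite invr_ge0 mulr_ge0// ltW|exact: ltW] => h.
rewrite (_ : [set x | _] = `[z, +oo[%classic); last first.
  by apply/seteqP; split => s /=; rewrite in_itv/= andbT.
have z2 : (0 < (2 / z)%:E)%E by rewrite lte_fin divr_gt0.
move: h; rewrite -(lee_pmul2l _ z2)// muleA -EFinM.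
rewrite (_ : 2 / z * (z / 2) = 1) ?mul1e; last by field; rewrite gt_eqF.
move=> /le_trans; apply; rewrite -EFinM lee_fin le_eqVlt; apply/orP; left; apply/eqP.
rewrite (_ : - (1 + lee_exponent b) = - 1 + - lee_exponent b); last by rewrite opprD.
rewrite (@powRD _ z (- 1)); last by rewrite (gt_eqF z0) implybT.
rewrite powR_inv1; last exact: ltW.
by field; rewrite gt_eqF.
Qed.

End lee.

(** * From critical moments to the slopes of the smile *)

Section lee_formula.
Context {R : realType}.
Implicit Types a b c : R.

Definition lee_slope a : R := 2 - 4 * (Num.sqrt (a ^+ 2 + a) - a).

(** This amounts to [a <= sqrt (a^2 + a) < a + 1 / 2]. *)
Lemma lee_slope_bounds a : 0 <= a -> 0 < lee_slope a <= 2.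
Proof.
move=> a0; rewrite /lee_slope; set s := Num.sqrt _.
have a20 : 0 <= a ^+ 2 + a by rewrite addr_ge0// sqr_ge0.
have s0 : 0 <= s by exact: sqrtr_ge0.
have s2 : s ^+ 2 = a ^+ 2 + a by rewrite sqr_sqrtr.
have s_ge : a <= s by rewrite -(@ler_pXn2r _ 2)// ?nnegrE// s2; lra.
have s_lt : s < a + 1 / 2.
  by rewrite -(@ltr_pXn2r _ 2)// ?nnegrE//; [rewrite s2; lra|lra].
lra.
Qed.

(** The slope [p = lee_slope a] solves [(2 - p)^2 = 8 p a]. For [0 < b < p <= 2] the left side grows
    strictly and the right side does not grow when [p] is replaced by [b]. *)
Lemma lt_lee_exponent a b : 0 <= a -> 0 < b -> b < lee_slope a ->
  a < lee_exponent b.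
Proof.
move=> a0 b0 bp.
have /andP[p0 p2] := lee_slope_bounds a0.
have p_root : (2 - lee_slope a) ^+ 2 = 8 * lee_slope a * a.
  have : Num.sqrt (a ^+ 2 + a) ^+ 2 = a ^+ 2 + a.
    by rewrite sqr_sqrtr// addr_ge0// sqr_ge0.
  by rewrite /lee_slope; move: (Num.sqrt _) => s s2; ring: s2.
rewrite /lee_exponent ltr_pdivlMr; last by rewrite mulr_gt0.
move: (lee_slope a) p0 p2 p_root bp => p p0 p2 pr bp.
have h1 : a * (8 * b) <= 8 * p * a by nra.
apply: (le_lt_trans h1); rewrite -pr; nra.
Qed.

Lemma limf_esup_ltP (F : set_system R) (f : R -> R) c : 0 < c ->
  (limf_esup (fun K => (f K)%:E) F < c%:E)%E ->
  exists2 V, F V & exists b, [/\ 0 < b, b < c & forall K, V K -> f K <= b].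
Proof.
move=> c0; rewrite limf_esupE => /ereal_inf_lt [_ [V FV <-] Vc].
exists V => //.
have : forall K, V K -> ((f K)%:E <= ereal_sup ((fun K => (f K)%:E) @` V))%E.
  by move=> K VK; apply: ereal_sup_ubound; exists K.
case: (ereal_sup _) Vc => [s| |]//.
(* The supremum [s] may be negative; the maximum with [c / 2] keeps the bound positive and still
   below [c]. *)
- rewrite lte_fin => sc fs; exists (Num.max s (c / 2)); split.
  + by rewrite lt_max; apply/orP; right; rewrite divr_gt0.
  + by rewrite gt_max sc/=; lra.
  + by move=> K /fs; rewrite lee_fin le_max => ->.
- move=> _ fs; exists (c / 2); split; [by rewrite divr_gt0|lra|].
  by move=> K /fs.
Qed.

Section moment_formula.
Variable mu : probability (measurableTypeR R) R.
Hypothesis mu_gt0 : mu `]-oo, 0]%classic = 0%E.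
Hypothesis imu : mu.-integrable setT EFin.
Variables (r t T : R).
Hypothesis tT : t < T.

(** Otherwise the normalized implied variance stays below some [b < lee_slope a] near 0. All moments
    below [lee_exponent b > a] are then finite, and the midpoint [q] exceeds the critical moment. *)
Lemma lee_left a : 0 <= a -> (critical_neg_moment mu <= a%:E)%E ->
  ((lee_slope a)%:E <= beta_left mu r t T)%E.
Proof.
move=> a0 crit; rewrite leNgt; apply/negP => /limf_esup_ltP.
have /andP[p0 p2] := lee_slope_bounds a0.
move=> /(_ p0) [V [D /= D0 DV] [b [b0 bp ivb]]].
have ab := lt_lee_exponent a0 b0 bp.
pose q := (a + lee_exponent b) / 2.
have aq : a < q by rewrite /q; lra.
have qb : q < lee_exponent b by rewrite /q; lra.
have q0 : 0 <= q by lra.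
have fin : (\int[mu]_s (s `^ (- q))%:E < +oo)%E.
  apply: (neg_moment_of_implied_vol mu_gt0 imu tT _ D0 q0 qb).
    by apply/andP; split => //; lra.
  move=> K /andP[K0 KD]; apply: ivb; apply: DV => //=.
  by rewrite sub0r normrN gtr0_norm.
have : (q%:E <= critical_neg_moment mu)%E.
  by apply: ereal_sup_ubound; exists q.
by move=> /le_trans /(_ crit); rewrite lee_fin leNgt aq.
Qed.

Lemma lee_right a : 0 <= a -> (critical_pos_moment mu <= a%:E)%E ->
  ((lee_slope a)%:E <= beta_right mu r t T)%E.
Proof.
move=> a0 crit; rewrite leNgt; apply/negP => /limf_esup_ltP.
have /andP[p0 p2] := lee_slope_bounds a0.
move=> /(_ p0) [V [M [_ MV]] [b [b0 bp ivb]]].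
have ab := lt_lee_exponent a0 b0 bp.
pose q := (a + lee_exponent b) / 2.
have aq : a < q by rewrite /q; lra.
have qb : q < lee_exponent b by rewrite /q; lra.
have q0 : 0 <= q by lra.
have fin : (\int[mu]_s (s `^ (1 + q))%:E < +oo)%E.
  apply: (pos_moment_of_implied_vol (r := r) (M := M) mu_gt0 imu tT _ q0 qb).
    by apply/andP; split => //; lra.
  by move=> K MK; apply: ivb; exact: MV.
have : (q%:E <= critical_pos_moment mu)%E.
  by apply: ereal_sup_ubound; exists q.
by move=> /le_trans /(_ crit); rewrite lee_fin leNgt aq.
Qed.

End moment_formula.
End lee_formula.

(** * Proof of the proposition *)

Lemma integrable_price {R : realType} {d : measure_display} {Omega : measurableType d}
    (P : probability Omega R) (F : R -> set_system Omega) (r h u : R)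
    (S : R -> Omega -> R) : 0 <= u <= h ->
  martingale_on P F h (fun u w => S u w * expR (- r * u)) ->
  P.-integrable setT (EFin \o S u).
Proof.
move=> uh [_ /(_ u uh) iS _].
rewrite (_ : EFin \o S u = fun w =>
  ((expR (r * u))%:E * (S u w * expR (- r * u))%:E)%E); first exact: integrableZl.
apply/funext => w /=; rewrite -EFinM mulrCA -expRD mulNr subrr expR0.
by rewrite mulr1.
Qed.

Lemma integral_powR1_lty {R : realType} (mu : probability (measurableTypeR R) R) :
  mu.-integrable setT EFin -> (\int[mu]_s (s `^ 1)%:E < +oo)%E.
Proof.
move=> imu.
have h : mu.-integrable setT ((EFin \o cst 1) \+ (fun s => `|s%:E|)%E).
  apply: integrableD => //; first exact: finite_measure_integrable_cst.
  exact: integrable_abse.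
have /integrable_lty : mu.-integrable setT (fun s => (s `^ 1)%:E).
  apply: (le_integrable measurableT _ _ h).
    by apply/measurable_EFinP; exact: measurable_powR.
  move=> s _; rewrite /= lee_fin ger0_norm ?powR_ge0//.
  apply: le_trans (ler_norm _); have [s0|s0] := leP 0 s.
    by rewrite powRr1// ger0_norm// lerDr.
  by rewrite lt0_powR1// lerDl.
exact.
Qed.

Theorem proposition3p3 (R : realType) (d : measure_display)
    (Omega : measurableType d) (P : probability Omega R)
    (F : R -> set_system Omega) (r tau t T : R)
    (W sigma S : R -> Omega -> R) (VIX_T : Omega -> R)
    (lawVIX lawS_T lawS_Ttau : Omega -> probability (measurableTypeR R) R) :
  0 <= r -> 0 < tau -> 0 <= t -> t < T ->
  filtration F ->
  stoch_vol_model P F r W sigma S ->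
  martingale_on P F (T + tau) (fun u w => S u w * expR (- r * u)) ->
  finite_expected_variance P F (T + tau) sigma ->
  is_VIX P F tau S T VIX_T ->
  is_cond_law P (F t) VIX_T lawVIX ->
  is_cond_law P (F t) (S T) lawS_T ->
  is_cond_law P (F t) (S (T + tau)) lawS_Ttau ->
  {ae P, forall w,
    let xi := critical_exp_sq (lawVIX w) in
    let a := 4 * fine xi / tau in
    ((xi < +oo)%E ->
     (\int[lawS_T w]_s (s `^ a)%:E < +oo)%E ->
     let bound := 2 - 4 * (Num.sqrt (a ^+ 2 + a) - a) in
     [/\ (critical_neg_moment (lawS_Ttau w) <= a%:E)%E,
         (bound%:E <= beta_left (lawS_Ttau w) r t (T + tau))%E &
         0 <= bound])
    /\
    ((0 < xi)%E -> (xi < +oo)%E ->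
     (\int[lawS_Ttau w]_s (s `^ (- a))%:E < +oo)%E ->
     let bound := 2 - 4 * (Num.sqrt ((a - 1) ^+ 2 + a - 1) - (a - 1)) in
     [/\ 1 <= a,
         (critical_pos_moment (lawS_T w) <= (a - 1)%:E)%E,
         (bound%:E <= beta_right (lawS_T w) r t T)%E,
         bound = - 2 - 4 * (Num.sqrt (a ^+ 2 - a) - a) &
         0 <= bound])}.
Proof.
move=> r0 tau0 t0 tT filF [_ _ adS S0 _] mart _ vix lV lY lX.
have T0 : 0 <= T by exact: le_trans (ltW tT).
have Ttau0 : 0 <= T + tau by rewrite addr_ge0// ltW.
have tTtau : t < T + tau by rewrite ltr_wpDr// ltW.
have S_gt0 u w : 0 <= u -> 0 < S u w by exact: S0.
have [sF subF _] := filF.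
have mY : measurable_fun setT (S T).
  exact: (sub_measurable_measurable (subF _ T0) (adS _ T0)).
have mX : measurable_fun setT (S (T + tau)).
  exact: (sub_measurable_measurable (subF _ Ttau0) (adS _ Ttau0)).
have iY : P.-integrable setT (EFin \o S T).
  by apply: (integrable_price _ mart); rewrite T0 lerDl ltW.
have iX : P.-integrable setT (EFin \o S (T + tau)).
  by apply: (integrable_price _ mart); rewrite Ttau0 lexx.
have pos u w : 0 <= u -> ~ `]-oo, 0]%classic (S u w).
  by move=> u0; rewrite /= in_itv/= leNgt S_gt0.
have nY := cond_law_null (sF _ t0) (subF _ t0) lY (measurable_itv `]-oo, 0])
  (fun w => pos _ w T0).
have nX := cond_law_null (sF _ t0) (subF _ t0) lX (measurable_itv `]-oo, 0])
  (fun w => pos _ w Ttau0).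
have liY := cond_law_integrable (sF _ t0) (subF _ t0) mY lY iY.
have liX := cond_law_integrable (sF _ t0) (subF _ t0) mX lX iX.
have crit := critical_exp_sq_VIX_ge tau0 t0 tT filF adS S_gt0 mart vix lV lY lX.
apply: filterS3 (filterI nY nX) (filterI liY liX) crit => w [nYw nXw] [iYw iXw] critw.
(* Nonnegativity excludes the value [-oo]; at [+oo] both parts are vacuous. *)
have := critical_exp_sq_ge0 (lawVIX w).
move: critw; case: (critical_exp_sq (lawVIX w)) => [x| |]//= critw.
rewrite lee_fin => x0; set a := 4 * x / tau.
have a0 : 0 <= a by rewrite divr_ge0 ?mulr_ge0// ltW.
(* The bound on [mix_exponent q b], multiplied by [4 (q + b) / tau]. *)
have key q b : 0 < q -> 0 < b ->
    (\int[lawS_Ttau w]_s (s `^ (- q))%:E < +oo)%E ->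
    (\int[lawS_T w]_s (s `^ b)%:E < +oo)%E -> 2 * (q * b) <= a * (q + b).
  move=> q0 b0 Xq Yb; have := critw _ _ q0 b0 Xq Yb.
  rewrite lee_fin /mix_exponent => h.
  rewrite -ler_pdivrMr ?addr_gt0// /a ler_pdivlMr//.
  rewrite (_ : 2 * (q * b) / (q + b) * tau = 4 * (tau / 2 * (q * b / (q + b)))).
    by rewrite ler_pM2l.
  by field; rewrite gt_eqF ?addr_gt0.
have Y1 := integral_powR1_lty iYw.
split=> [_ Ya|x_gt0 _ Xa].
  have crit_neg : (critical_neg_moment (lawS_Ttau w) <= a%:E)%E.
    apply: ge_ereal_sup => _ [q [q0 Xq] <-]; rewrite lee_fin.
    move: q0; rewrite le_eqVlt => /predU1P[<-//|q0].
    (* With [b = a], [key] gives [q <= a] at once. With [b = 1] it gives [q (2 - a) <= a], and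
       [2 - a > 1] when [a < 1]. *)
    have [a1|a1] := leP 1 a.
      by have := key q a q0 (lt_le_trans ltr01 a1) Xq Ya; nra.
    by have := key q 1 q0 ltr01 Xq Y1; nra.
  have /andP[b0 _] := lee_slope_bounds a0.
  by split => //; [exact: lee_left|exact: ltW].
have a_gt0 : 0 < a by rewrite divr_gt0 ?mulr_gt0// -lte_fin.
(* Here [q = a] and [b = 1], so [2 a <= a (a + 1)]. *)
have a1 : 1 <= a by have := key a 1 a_gt0 ltr01 Xa Y1; nra.
have crit_pos : (critical_pos_moment (lawS_T w) <= (a - 1)%:E)%E.
  apply: ge_ereal_sup => _ [p [p0 Yp] <-]; rewrite lee_fin.
  have p1 : 0 < 1 + p by rewrite ltr_wpDr.
  (* Dividing [2 a (1 + p) <= a (a + 1 + p)] by [a] leaves [1 + p <= a]. *)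
  by have := key a (1 + p) a_gt0 p1 Xa Yp; nra.
have a10 : 0 <= a - 1 by rewrite subr_ge0.
have /andP[b0 _] := lee_slope_bounds a10.
rewrite (_ : (a - 1) ^+ 2 + a - 1 = (a - 1) ^+ 2 + (a - 1)); last by rewrite addrA.
rewrite -/(lee_slope (a - 1)); split => //.
- exact: lee_right.
- rewrite /lee_slope (_ : (a - 1) ^+ 2 + (a - 1) = a ^+ 2 - a); last by ring.
  by ring.
- exact: ltW.
Qed.
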